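(* Let $F$ be a field of characteristic $0$ and $n\ge 1$ an integer. Then the algebra $T_n$ of monotypically supersymmetric polynomials is generated, as an $F$-algebra, by the odd power sums $p_{2k+1}$, $k=0,1,2,\dots$. Moreover, the proper products form a linear basis of $T_n$ over $F$; that is, the family of proper products, indexed by their data $(c_1,c_3,\dots,c_{2j+1};\{m_1,\dots,m_{i'}\})$ with $c_{2\ell+1}\ge 0$, $0\le i'\le i$, and $\{m_1,\dots,m_{i'}\}$ a multiset of integers $>j$, is linearly independent and spans $T_n$.
   Context: $F$ is a field with $\operatorname{char}F=0$. For $n\ge 1$ and $k\ge 0$, $p_k=x_1^k+\dots+x_n^k\in F[x_1,\dots,x_n]$ (power sums). A polynomial $p\in F[x_1,\dots,x_n]$ is called monotypically supersymmetric if (1) $p$ is invariant under all permutations of $x_1,\dots,x_n$, and (2) after the substitution $x_1=t,\ x_2=-t$ (other variables unchanged) the resulting polynomial does not depend on $t$. $T_n$ denotes the $F$-algebra of monotypically supersymmetric polynomials in $n$ variables. Put $i=i(n)=\lfloor n/2\rfloor$ (largest integer with $2i\le n$) and $j=j(n)=\lfloor (n-1)/2\rfloor$ (largest integer with $2j+1\le n$). A proper product is a polynomial of the form $p_1^{c_1}p_3^{c_3}\cdots p_{2j+1}^{c_{2j+1}}\,p_{2m_1+1}\cdots p_{2m_{i'}+1}$ where $c_1,c_3,\dots,c_{2j+1}\ge 0$ are integers, $0\le i'\le i$, and $m_1,\dots,m_{i'}$ are integers with $m_k>j$ for all $k$ (i.e. it contains at most $i$ factors $p_{2m+1}$ with $m>j$,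 counted with multiplicity). *)

(* Defs.v *)
From HB Require Import structures.
From mathcomp Require Import all_boot all_algebra.
From mathcomp Require Import multinomials.mpoly.
Set Implicit Arguments. Unset Strict Implicit. Unset Printing Implicit Defensive.
Import GRing.Theory.
Local Open Scope ring_scope.

Definition psum (F : fieldType) (n k : nat) : {mpoly F[n]} :=
  \sum_(l < n) 'X_l ^+ k.

(* Substitution x_1 := t, x_2 := -t (variables 0 and 1 in 0-based indexing),
   other variables unchanged; the result is a polynomial in the new
   variable t with coefficients in F[x_1,...,x_n]. *)
Definition subst_tmt (F : fieldType) (n : nat) (p : {mpoly F[n]})
  : {poly {mpoly F[n]}} :=
  mmap (fun c : F => (c%:MP)%:P)
       (fun l : 'I_n => if (l : nat) == 0%N then 'X
                        else if (l : nat) == 1%N then - 'X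
                        else ('X_l)%:P) p.

(* Monotypically supersymmetric: symmetric, and after x1=t, x2=-t the
   polynomial does not depend on t (it is constant in t).  When n = 1 there
   is no variable x2, and condition (2) is vacuous. *)
Definition mono_supersym (F : fieldType) (n : nat) (p : {mpoly F[n]}) : Prop :=
  p \is symmetric /\ ((1 < n)%N -> (size (subst_tmt p) <= 1)%N).

Definition ii (n : nat) : nat := n./2.
Definition jj (n : nat) : nat := n.-1./2.       (* largest j with 2j+1 <= n, n >= 1 *)

(* Data of a proper product: exponents (c_1, c_3, ..., c_{2j+1}) and the
   multiset {m_1, ..., m_i'} represented canonically as a sorted list. *)
Definition pp_index (n : nat) : Type := ((jj n).+1.-tuple nat * seq nat)%type.

Definition pp_valid (n : nat) (x : pp_index n) : bool :=
  [&& sorted leq x.2, all (fun m => jj n < m)%N x.2 & (size x.2 <= ii n)%N].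

Definition proper_prod (F : fieldType) (n : nat) (x : pp_index n) : {mpoly F[n]} :=
  (\prod_(l < (jj n).+1) psum F n (2 * l + 1) ^+ tnth x.1 l)
  * \prod_(m <- x.2) psum F n (2 * m + 1).

Definition in_odd_psum_alg (F : fieldType) (n : nat) (p : {mpoly F[n]}) : Prop :=
  exists (m : nat) (q : {mpoly F[m]}),
    p = mmap (fun c : F => c%:MP) (fun k : 'I_m => psum F n (2 * k + 1)) q.

(* Main.v *)
(* Write E(x) = \sum_k e_k x^k = A(x^2) + x B(x^2) for the generating function
   of the elementary symmetric polynomials, and R(y) = B(y) / A(y) =
   \sum_m r_m y^m.  Newton's identities give P = R + 2 y R' + y R^2 P for
   P(y) = \sum_m p_(2m+1) y^m, so p_(2m+1) = (2m+1) r_m modulo products of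
   r's of smaller total index, and it suffices to study products of r's.

   Independence.  A and r_0, ..., r_j are algebraically independent, and r_m
   for m > j is determined by the linear recurrence with coefficients
   e_2, e_4, ..., e_(2i).  Giving r_s weight s for s <= j, the leading part of
   r_m for m > j is r_j h_(m-j), where \sum_m h_m y^m = 1 / A.  So the claim
   reduces to the independence of the products of at most i complete
   symmetric polynomials in i variables, which are unitriangular in the
   Jacobi-Trudi determinants.

   Spanning.  By induction from n - 2 to n, setting the last two variables to
   0, one may assume that f vanishes whenever x_a = - x_b.  Then f is divisible
   by \prod_(a < b) (x_a + x_b), which is up to a scalar the i x i Hankel
   determinant D of the r's (its first index is the parity of n).  Finally
   D s(A), for a Jacobi-Trudi determinant s, is a minor of the Hankel matrix of
   the r's, hence a combination of products of exactly i of them, and such s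
   span the polynomials in the coefficients of A. *)
Require Import Defs.
From HB Require Import structures.
From mathcomp Require Import all_boot all_algebra all_fingroup.
From mathcomp Require Import multinomials.mpoly.
From mathcomp Require Import ring zify.
Set Implicit Arguments. Unset Strict Implicit. Unset Printing Implicit Defensive.
Import GRing.Theory.
Local Open Scope ring_scope.

(** * Quotients of power series *)

Section Series.
Variable S : comNzRingType.
Implicit Types a b u v : nat -> S.

Definition sconv a u m := \sum_(t < m.+1) a t * u (m - t)%N.

(** Course-of-values recursion for the coefficients of the series [b / a]. The value [a 0] is never
    read: the constant term of the divisor is taken to be 1. *)
Fixpoint sdivs a b m : seq S :=
  if m is m'.+1 then
    let s := sdivs a b m' in
    rcons s (b m' - \sum_(t < m') a t.+1 * s`_(m' - t.+1))
  else [::].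

Definition sdiv a b m := (sdivs a b m.+1)`_m.

Lemma size_sdivs a b m : size (sdivs a b m) = m.
Proof. by elim: m => //= m IH; rewrite size_rcons IH. Qed.

Lemma nth_sdivs a b m k : (k < m)%N -> (sdivs a b m)`_k = sdiv a b k.
Proof.
elim: m => // m IH; rewrite ltnS leq_eqVlt => /orP[/eqP->//|lkm].
by rewrite /= nth_rcons size_sdivs lkm IH.
Qed.

Lemma sdivE a b m :
  sdiv a b m = b m - \sum_(t < m) a t.+1 * sdiv a b (m - t.+1)%N.
Proof.
rewrite {1}/sdiv /= nth_rcons size_sdivs ltnn eqxx.
congr (_ - _); apply: eq_bigr => t _; rewrite nth_sdivs //.
by case: t => t /= lt; lia.
Qed.

Lemma sconv_sdiv a b m : a 0%N = 1 -> sconv a (sdiv a b) m = b m.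
Proof.
move=> a0; rewrite /sconv big_ord_recl a0 mul1r subn0 sdivE.
by rewrite /bump /= subrK.
Qed.

Lemma sconv_inj a u v N : a 0%N = 1 ->
    (forall m, (m < N)%N -> sconv a u m = sconv a v m) ->
  forall m, (m < N)%N -> u m = v m.
Proof.
move=> a0 H m; elim/ltn_ind: m => m IH lmN; have := H m lmN.
rewrite /sconv !big_ord_recl a0 !mul1r !subn0.
rewrite (eq_bigr (fun t : 'I_m => a (bump 0 t) * v (m - bump 0 t)%N)).
  by move/addIr.
case=> t lt _; rewrite IH //= /bump; lia.
Qed.

Lemma sdiv_uniq a b u N : a 0%N = 1 ->
    (forall m, (m < N)%N -> sconv a u m = b m) ->
  forall m, (m < N)%N -> u m = sdiv a b m.
Proof.
by move=> a0 H; apply: (sconv_inj a0) => m lm; rewrite sconv_sdiv ?H.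
Qed.

Lemma eq_sdiv a a' b b' : (forall t, a t.+1 = a' t.+1) -> b =1 b' ->
  sdiv a b =1 sdiv a' b'.
Proof.
move=> Ea Eb m; elim/ltn_ind: m => m IH; rewrite !sdivE Eb; congr (_ - _).
by apply: eq_bigr => t _; rewrite Ea IH //; case: t => t /= lt; lia.
Qed.

Lemma sconvC a b : sconv a b =1 sconv b a.
Proof.
move=> m; rewrite /sconv (reindex_inj rev_ord_inj) /=.
apply: eq_bigr => -[t lt] _ /=; rewrite mulrC; congr (b _ * a _); lia.
Qed.

(** Truncation moves convolution identities into [{poly S}], where derivation and [ring] apply. *)
Lemma coef_sconv a b N m : (m < N)%N ->
  sconv a b m = ((\poly_(k < N) a k) * (\poly_(k < N) b k))`_m.
Proof.
move=> lm; rewrite coefM; apply: eq_bigr => -[t lt] _ /=.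
by rewrite !coef_poly; case: ltnP => ?; [case: ltnP => ? //; lia | lia].
Qed.

End Series.

Lemma rmorph_sdiv (S S' : comNzRingType) (f : {rmorphism S -> S'}) a b m :
  f (sdiv a b m) = sdiv (f \o a) (f \o b) m.
Proof.
elim/ltn_ind: m => m IH; rewrite !sdivE rmorphB rmorph_sum; congr (_ - _).
by apply: eq_bigr => t _; rewrite rmorphM IH //; case: t => t /= lt; lia.
Qed.

(* The even and odd parts of [E(x) = \sum_k e k x^k] are [A(x^2)] and
   [x B(x^2)]; [rser e] is the power series [R = B / A], and [pser e] solves
   [P = (R + 2 y R') + y R^2 P]. *)
Definition rser (S : comNzRingType) (e : nat -> S) : nat -> S :=
  sdiv (fun t => e (2 * t)%N) (fun t => e (2 * t + 1)%N).

Definition pser (S : comNzRingType) (e : nat -> S) : nat -> S :=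
  sdiv (fun t => - sconv (rser e) (rser e) t.-1)
       (fun m => (2 * m + 1)%:R * rser e m).

Lemma rmorph_rser (S S' : comNzRingType) (f : {rmorphism S -> S'}) e m :
  f (rser e m) = rser (f \o e) m.
Proof. exact: rmorph_sdiv. Qed.

Lemma rmorph_pser (S S' : comNzRingType) (f : {rmorphism S -> S'}) e m :
  f (pser e m) = pser (f \o e) m.
Proof.
rewrite rmorph_sdiv; apply: eq_sdiv => t /=.
  rewrite rmorphN rmorph_sum; congr (- _); apply: eq_bigr => s _.
  by rewrite rmorphM !rmorph_rser.
by rewrite rmorphM rmorph_rser rmorph_nat.
Qed.

Lemma eq_rser (S : comNzRingType) (e e' : nat -> S) : e =1 e' -> rser e =1 rser e'.
Proof. by move=> E; apply: eq_sdiv => t; rewrite !E. Qed.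

Lemma eq_pser (S : comNzRingType) (e e' : nat -> S) : e =1 e' -> pser e =1 pser e'.
Proof.
move=> E; apply: eq_sdiv => t; last by rewrite (eq_rser E).
by congr (- _); apply: eq_bigr => s _; rewrite !(eq_rser E).
Qed.

Lemma pserE (S : comNzRingType) (e : nat -> S) m :
  pser e m = (2 * m + 1)%:R * rser e m
    + \sum_(t < m) sconv (rser e) (rser e) t * pser e (m - t.+1)%N.
Proof.
rewrite /pser sdivE; congr (_ + _); rewrite -sumrN; apply: eq_bigr => t _ /=.
by rewrite mulNr opprK.
Qed.

Lemma sconv_rser (S : comNzRingType) (e : nat -> S) m : e 0%N = 1 ->
  sconv (fun t => e (2 * t)%N) (rser e) m = e (2 * m + 1)%N.
Proof. by move=> e0; rewrite /rser sconv_sdiv. Qed.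

(** * Newton's identities *)

Section ElementarySymmetric.
Variables (S : comNzRingType) (n : nat) (v : 'I_n -> S).

Definition esy k := \sum_(h : {set 'I_n} | #|h| == k) \prod_(l in h) v l.

(** Both variables are kept: [y = 1] gives the generating function of the [esy], while [x = -1],
    [y = z l] makes a factor vanish and yields a linear recurrence. *)
Lemma prod_esy (x y : S) :
  \prod_(l < n) (y + x * v l) = \sum_(k < n.+1) esy k * x ^+ k * y ^+ (n - k).
Proof.
under eq_bigr => l _ do rewrite addrC.
rewrite bigA_distr.
have H (h : {set 'I_n}) : (#|h| < n.+1)%N.
  by rewrite ltnS -[leqRHS](card_ord n) max_card.
rewrite (partition_big (fun h : {set 'I_n} => inord #|h| : 'I_n.+1) xpredT) //=.
apply: eq_bigr => k _; rewrite /esy !mulr_suml.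
have E (h : {set 'I_n}) : (inord #|h| == k :> 'I_n.+1) = (#|h| == k).
  by rewrite -val_eqE /= inordK ?H.
rewrite (eq_bigl _ _ E); apply: eq_bigr => h /eqP hk.
rewrite (bigID (mem h)) /=.
rewrite (eq_bigr (fun l => x * v l)); last by move=> l ->.
rewrite [X in _ * X](eq_bigr (fun=> y)); last by move=> l /negbTE->.
rewrite big_split /= !prodr_const hk [X in X * _]mulrC; congr (_ * _ ^+ _).
have := cardC (mem h); rewrite card_ord hk => /(canRL (addKn _)) <-.
exact: eq_card.
Qed.

Lemma esy0 : esy 0 = 1.
Proof.
rewrite /esy (big_pred1 set0) ?big_set0 // => h.
by rewrite cards_eq0.
Qed.

Lemma esy_gt k : (n < k)%N -> esy k = 0.
Proof.
move=> lk; rewrite /esy big_pred0 // => h; apply/negbTE.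
by rewrite neq_ltn (leq_ltn_trans _ lk) // -[leqRHS](card_ord n) max_card.
Qed.

End ElementarySymmetric.

Lemma eq_esy (S : comNzRingType) n (v w : 'I_n -> S) : v =1 w -> esy v =1 esy w.
Proof.
by move=> E k; apply: eq_bigr => h _; apply: eq_bigr => l _; rewrite E.
Qed.

Lemma mesymE_esy (F : fieldType) n k :
  mesym n F k = esy (fun l : 'I_n => 'X_l : {mpoly F[n]}) k.
Proof. by []. Qed.

Lemma rmorph_esy (S S' : comNzRingType) (f : {rmorphism S -> S'}) n
    (v : 'I_n -> S) k : f (esy v k) = esy (f \o v) k.
Proof.
by rewrite rmorph_sum; apply: eq_bigr => h _; rewrite rmorph_prod.
Qed.

Definition egen (S : comNzRingType) n (v : 'I_n -> S) : {poly S} :=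
  \prod_(l < n) (1 + 'X * (v l)%:P).

Lemma coef_egen (S : comNzRingType) n (v : 'I_n -> S) k : (egen v)`_k = esy v k.
Proof.
have -> : egen v = \poly_(t < n.+1) esy v t.
  rewrite /egen (prod_esy (fun l => (v l)%:P) 'X 1) poly_def.
  apply: eq_bigr => t _; rewrite expr1n mulr1.
  by rewrite -(rmorph_esy (polyC : {rmorphism S -> {poly S}})) mul_polyC.
by rewrite coef_poly; case: ltnP => // ?; rewrite esy_gt.
Qed.

Section Newton.
Variables (S : comNzRingType) (n : nat) (v : 'I_n -> S).
Let p k := \sum_(l < n) v l ^+ k.
Implicit Types a b q : {poly S}.

(** Congruence to 0 modulo ['X^N], in which truncated series identities are stated. *)
Definition zerob (N : nat) (q : {poly S}) := forall k, (k < N)%N -> q`_k = 0.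

Lemma zerobM N a q : zerob N q -> zerob N (a * q).
Proof.
move=> z k lk; rewrite coefM big1 // => -[t lt] _ /=.
by rewrite (z (k - t)%N) ?mulr0 //; lia.
Qed.

Lemma zerobD N a b : zerob N a -> zerob N b -> zerob N (a + b).
Proof. by move=> za zb k lk; rewrite coefD za ?zb ?addr0. Qed.

Lemma zerobB N a b : zerob N a -> zerob N b -> zerob N (a - b).
Proof. by move=> za zb k lk; rewrite coefB za ?zb ?subr0. Qed.

Lemma zerob_deriv N a : zerob N a -> zerob N ('X * a^`()).
Proof.
by move=> za [|k] lk; rewrite coefXM //= coef_deriv za ?mul0rn.
Qed.

Lemma zerobKM N a q : a`_0 = 1 -> zerob N (a * q) -> zerob N q.
Proof.
move=> a0 z k; elim/ltn_ind: k => k IH lk.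
have := z k lk; rewrite coefM big_ord_recl a0 mul1r subn0 big1 ?addr0 //.
by case=> t lt _ /=; rewrite IH ?mulr0 //= /bump; lia.
Qed.

(** Logarithmic derivative: the factor [1 + v_l X] contributes [v_l / (1 + v_l X)], whose geometric
    series is cut after [N] terms. *)
Lemma deriv_egen N :
  zerob N ((egen v)^`() - egen v * \sum_(l < n) (v l)%:P * \sum_(s < N) (- 'X * (v l)%:P) ^+ s).
Proof.
rewrite /egen; elim: (index_enum _) => [|l r IH].
  by rewrite !big_nil mulr0 subr0 -polyC1 derivC => k _; rewrite coef0.
rewrite !big_cons derivM derivD -polyC1 derivC add0r derivM derivX derivC.
rewrite mul1r mulr0 addr0 polyC1.
set E := \prod_(_ <- r) _ in IH *; set G := \sum_(_ <- r) _ in IH *.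
have := subrX1 (- 'X * (v l)%:P) N; set H := \sum_(_ < _) _ => HH.
have -> : (v l)%:P * E + (1 + 'X * (v l)%:P) * E^`() -
    (1 + 'X * (v l)%:P) * E * ((v l)%:P * H + G)
  = (1 + 'X * (v l)%:P) * (E^`() - E * G)
    + (v l)%:P * E * ((- 'X * (v l)%:P - 1) * H + 1) by ring.
apply: zerobD; first exact: zerobM.
(* By the geometric sum [HH] the remaining factor is [(- 'X * v_l) ^+ N]. *)
apply: zerobM; rewrite -HH subrK => k lk.
by rewrite mulNr exprNn exprMn -rmorphXn /= mulrCA coefXnM lk.
Qed.

Lemma coef_powers N k : (k < N)%N ->
  (\sum_(l < n) (v l)%:P * \sum_(s < N) (- 'X * (v l)%:P) ^+ s)`_k
    = (-1) ^+ k * p k.+1.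
Proof.
move=> lk; rewrite coef_sum /p mulr_sumr; apply: eq_bigr => l _.
rewrite coefCM coef_sum (bigD1 (Ordinal lk)) //= big1 ?addr0.
  rewrite mulNr exprNn exprMn mulrCA -rmorphXn /= -(rmorphN1 (polyC : {rmorphism S -> _})).
  by rewrite -rmorphXn /= coefXnM ltnn subnn -rmorphM /= coefC /= exprS mulrCA.
move=> t nt; rewrite mulNr exprNn exprMn mulrCA -rmorphXn /=.
rewrite -(rmorphN1 (polyC : {rmorphism S -> _})) -rmorphXn -rmorphM /= coefXnM.
case: ltnP => // le; rewrite coefC subn_eq0 leqNgt.
by rewrite -val_eqE /= in nt; rewrite ltn_neqAle nt le.
Qed.

Lemma newton k :
  esy v k.+1 *+ k.+1 = \sum_(t < k.+1) esy v t * ((-1) ^+ (k - t) * p (k - t).+1).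
Proof.
have /(_ k (ltnSn k)) := @deriv_egen k.+1.
rewrite coefB coef_deriv coef_egen coefM => /eqP; rewrite subr_eq0 => /eqP ->.
by apply: eq_bigr => -[t lt] _ /=; rewrite coef_egen coef_powers //; lia.
Qed.

Lemma sum_parity (f : nat -> S) k : \sum_(t < (2 * k).+1) f t =
  \sum_(s < k.+1) f (2 * s)%N + \sum_(s < k) f (2 * s + 1)%N.
Proof.
elim: k => [|k IH]; first by rewrite !big_ord1 !big_ord0 addr0.
have -> : ((2 * k.+1).+1 = (2 * k).+3)%N by lia.
rewrite 2!big_ord_recr IH /= [in RHS]big_ord_recr [X in _ + X = _]/=.
rewrite [X in _ = _ + X]big_ord_recr /=.
have -> : (2 * k.+1 = (2 * k).+2)%N by lia.
by rewrite addn1; ring.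
Qed.

(** Newton's identities say [E' = E * (P(x^2) - x O(x^2))], where [O] collects the even power sums.
    The even and odd parts are [h1] and [h2]; eliminating [O] and dividing by [A^2] leaves the
    equation that defines [pser]. *)
Lemma psum_pser m : \sum_(l < n) v l ^+ (2 * m + 1) = pser (esy v) m.
Proof.
elim/ltn_ind: m => m IH; set e := esy v in IH *.
have sgn t k : (t <= k)%N -> (-1) ^+ (k - t) = (-1) ^+ (odd k (+) odd t) :> S.
  by move=> ?; rewrite -signr_odd oddB.
pose N := m.+1; pose r := rser e.
pose A := \poly_(k < N) e (2 * k)%N; pose B := \poly_(k < N) e (2 * k + 1)%N.
pose P := \poly_(k < N) p (2 * k + 1)%N; pose O := \poly_(k < N) p (2 * k + 2)%N.
pose R := \poly_(k < N) r k.
have h1 : zerob N (A * P - 'X * B * O - (B + 2%:R * 'X * B^`())).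
  move=> k lk; have := newton (2 * k).
  rewrite (sum_parity (fun t => esy v t * ((-1) ^+ (2 * k - t) * p (2 * k - t).+1))).
  rewrite (eq_bigr (fun s : 'I_k.+1 => e (2 * s)%N * p (2 * (k - s) + 1)%N)); last first.
    move=> [t lt] _ /=; rewrite sgn; last by lia.
    rewrite !oddM /= expr0 mul1r; congr (_ * p _); lia.
  rewrite [X in _ = _ + X](eq_bigr (fun s : 'I_k => - (e (2 * s + 1)%N * p (2 * (k.-1 - s) + 2)%N))); last first.
    move=> [t lt] _ /=; rewrite sgn; last by lia.
    rewrite oddD !oddM /= expr1 mulN1r mulrN; congr (- (_ * p _)); lia.
  rewrite sumrN -mulrA !coefB !coefD -mulrA -(polyC_natr S 2) coefCM.
  rewrite !coefXM [B`_k]coef_poly lk -/(sconv _ _ _).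
  have -> : (A * P)`_k = \sum_(s < k.+1) e (2 * s)%N * p (2 * (k - s) + 1)%N.
    by rewrite -(coef_sconv (fun k => e (2 * k)%N) (fun k => p (2 * k + 1)%N)).
  case: k lk => [|k] lk /=.
    by rewrite !big_ord0 !subr0 mulr0 addr0 => <-; rewrite muln0 mulr1n subrr.
  rewrite coef_deriv [B`_k.+1]coef_poly lk.
  have -> : (B * O)`_k = \sum_(s < k.+1) e (2 * s + 1)%N * p (2 * (k - s) + 2)%N.
    by rewrite -(coef_sconv (fun k => e (2 * k + 1)%N) (fun k => p (2 * k + 2)%N)) //; lia.
  move=> <-; rewrite addn1 -[_ *+ k.+1]mulr_natl -[_ *+ _.+1]mulr_natl.
  rewrite -[(2 * k.+1).+1]addn1 natrD natrM -/e; ring.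
(* The truncation of [A] determines its derivative only below degree [N - 1], whence the factor
   ['X]. *)
have h2 : zerob N ('X * (B * P - A * O - 2%:R * A^`())).
  move=> [|k] lk; rewrite coefXM //=; have := newton (2 * k).+1.
  rewrite big_ord_recr /= subnn expr0 mul1r.
  rewrite (sum_parity (fun t => esy v t * ((-1) ^+ ((2 * k).+1 - t) * p ((2 * k).+1 - t).+1))).
  rewrite (eq_bigr (fun s : 'I_k.+1 => - (e (2 * s)%N * p (2 * (k - s) + 2)%N))); last first.
    move=> [t lt] _ /=; rewrite sgn; last by lia.
    rewrite /= !oddM /= expr1 mulN1r mulrN; congr (- (_ * p _)); lia.
  rewrite [X in _ = _ + X + _](eq_bigr (fun s : 'I_k => (e (2 * s + 1)%N * p (2 * (k - s) + 1)%N))); last first.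
    move=> [t lt] _ /=; rewrite sgn; last by lia.
    rewrite /= oddD !oddM /= expr0 mul1r; congr (_ * p _); lia.
  rewrite sumrN !coefB -(polyC_natr S 2) coefCM coef_deriv [A`_k.+1]coef_poly lk.
  have -> : (A * O)`_k = \sum_(s < k.+1) e (2 * s)%N * p (2 * (k - s) + 2)%N.
    by rewrite -(coef_sconv (fun k => e (2 * k)%N) (fun k => p (2 * k + 2)%N)) //; lia.
  have -> : (B * P)`_k = \sum_(s < k) e (2 * s + 1)%N * p (2 * (k - s) + 1)%N + e (2 * k).+1 * p 1.
    rewrite -(coef_sconv (fun k => e (2 * k + 1)%N) (fun k => p (2 * k + 1)%N)); last by lia.
    by rewrite /sconv big_ord_recr /= subnn muln0 addn1.
  have -> : (2 * k.+1 = (2 * k).+2)%N by lia.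
  have c2 : ((2 * k).+2%:R = 2%:R * k.+1%:R :> S) by rewrite -natrM; congr _%:R; lia.
  rewrite -/e -!(mulr_natl (e (2 * k).+2)) c2 => H.
  rewrite mulrA H; ring.
have h3 : zerob N (A * R - B).
  move=> k lk; rewrite coefB -(coef_sconv (fun k => e (2 * k)%N) r) //.
  by rewrite sconv_rser ?/e ?esy0 // [B`_k]coef_poly lk subrr.
have h3' := zerob_deriv h3.
have : zerob N (A ^+ 2 * (P - 'X * R ^+ 2 * P - R - 2%:R * 'X * R^`())).
  (* [A * h1 - B * h2] eliminates [O]; the multiples of [A * R - B] and of its derivative replace
     [B / A] by [R]. *)
  have -> : A ^+ 2 * (P - 'X * R ^+ 2 * P - R - 2%:R * 'X * R^`()) =
    A * (A * P - 'X * B * O - (B + 2%:R * 'X * B^`()))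
    - B * ('X * (B * P - A * O - 2%:R * A^`()))
    + (2%:R * 'X * A^`() - 'X * P * (A * R + B) - A) * (A * R - B)
    - 2%:R * A * ('X * (A * R - B)^`()).
    rewrite derivB derivM; ring.
  by apply: zerobB; [apply: zerobD; first apply: zerobB|]; apply: zerobM.
move/zerobKM => /(_ _ m (ltnSn m)).
have A0 : (A ^+ 2)`_0 = 1.
  by rewrite expr2 coefM big_ord1 subnn [A`_0]coef_poly /= /e esy0 mulr1.
move=> /(_ A0); rewrite -!mulrA !coefB -(polyC_natr S 2) coefCM !coefXM.
rewrite [P`_m]coef_poly [R`_m]coef_poly ltnSn.
rewrite pserE -/r.
case: m => [|m] in IH N A B P O R h1 h2 h3 h3' A0 * => /=.
  rewrite big_ord0 ?mulr0 ?addr0 ?mul1r ?subr0.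
  by move/eqP; rewrite subr_eq0 => /eqP.
rewrite coef_deriv [R`_m.+1]coef_poly ltnSn.
have -> : (R * (R * P))`_m = \sum_(t < m.+1) sconv r r t * pser e (m.+1 - t.+1)%N.
  rewrite mulrA coefM; apply: eq_bigr; case=> t lt _ /=.
  rewrite -coef_sconv; last by lia.
  by rewrite coef_poly subSS -IH; [case: ltnP => //; lia | lia].
move/eqP; rewrite -mulr_natl natrD natrM !subr_eq add0r /p => /eqP E.
rewrite E; ring.
Qed.

End Newton.

(** * Linear spans and linear recurrences *)

(** Spans are handled by induction, without index sets; an explicit finite family is recovered only
    in [lspan_finite]. *)
Inductive lspan (F : fieldType) (V : lmodType F) (Q : V -> Prop) : V -> Prop :=
| lspan0 : lspan Q 0
| lspanS c v w : Q v -> lspan Q w -> lspan Q (c *: v + w).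

Section Span.
Variables (F : fieldType) (V : lmodType F).
Implicit Types Q : V -> Prop.

Lemma lspan_add Q v w : lspan Q v -> lspan Q w -> lspan Q (v + w).
Proof.
move=> sv sw; elim: sv => [|c u u' Qu _ IH]; first by rewrite add0r.
by rewrite -addrA; apply: lspanS.
Qed.

Lemma lspan_scale Q c v : lspan Q v -> lspan Q (c *: v).
Proof.
elim=> [|d u u' Qu _ IH]; first by rewrite scaler0; apply: lspan0.
by rewrite scalerDr scalerA; apply: lspanS.
Qed.

Lemma lspan_mem Q v : Q v -> lspan Q v.
Proof. by move=> Qv; rewrite -[v]addr0 -[v]scale1r; apply: lspanS; last apply: lspan0. Qed.

Lemma lspan_sum Q (I : eqType) (s : seq I) (f : I -> V) :
  (forall x, x \in s -> lspan Q (f x)) -> lspan Q (\sum_(x <- s) f x).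
Proof.
move=> H; rewrite big_seq; apply: big_ind => //; first exact: lspan0.
exact: lspan_add.
Qed.

Lemma lspan_bind Q Q' v : (forall u, Q u -> lspan Q' u) -> lspan Q v -> lspan Q' v.
Proof.
move=> H; elim=> [|c u w Qu _ IH]; first exact: lspan0.
by apply: lspan_add => //; apply: lspan_scale; apply: H.
Qed.

End Span.

Lemma lspan_map (F : fieldType) (V V' : lmodType F) (f : V -> V')
    (Q : V -> Prop) (Q' : V' -> Prop) v :
  (forall c u w, f (c *: u + w) = c *: f u + f w) ->
  (forall u, Q u -> lspan Q' (f u)) -> lspan Q v -> lspan Q' (f v).
Proof.
move=> lf H; elim=> [|c u w Qu _ IH].
  by have := lf (-1) 0 0; rewrite scaler0 addr0 scaleN1r addNr => ->; apply: lspan0.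
by rewrite lf; apply: lspan_add => //; apply: lspan_scale; apply: H.
Qed.

Definition hser (S : comNzRingType) (a : nat -> S) : nat -> S :=
  sdiv a (fun m => (m == 0%N)%:R).

Definition hs (S : comNzRingType) (a : nat -> S) m s :=
  if (s <= m)%N then hser a (m - s) else 0.

(** For [nu k = t_k + k] this is the Jacobi-Trudi matrix of [t], with entries [h_(t_k + k - s)]. *)
Definition hmx (S : comNzRingType) (a : nat -> S) i (nu : 'I_i -> nat) :=
  \matrix_(k < i, s < i) hs a (nu k) s.

Definition recur (S : comNzRingType) i (a u : nat -> S) :=
  forall m, \sum_(t < i.+1) a t * u (m + i - t)%N = 0.

Lemma rmorph_hser (S S' : comNzRingType) (f : {rmorphism S -> S'}) a m :
  f (hser a m) = hser (f \o a) m.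
Proof. by rewrite rmorph_sdiv; apply: eq_sdiv => t //=; rewrite rmorph_nat. Qed.

Lemma eq_hser (S : comNzRingType) (a b : nat -> S) : a =1 b -> hser a =1 hser b.
Proof. by move=> E; apply: eq_sdiv => t. Qed.

Lemma eq_hmx (S : comNzRingType) (a b : nat -> S) i (nu : 'I_i -> nat) :
  a =1 b -> hmx a nu = hmx b nu.
Proof.
by move=> E; apply/matrixP => k l; rewrite !mxE /hs (eq_hser E).
Qed.

Lemma map_hmx (S S' : comNzRingType) (f : {rmorphism S -> S'}) a i (nu : 'I_i -> nat) :
  map_mx f (hmx a nu) = hmx (f \o a) nu.
Proof.
apply/matrixP => k l; rewrite !mxE /hs.
by case: ifP => _; rewrite ?rmorph0 // rmorph_hser.
Qed.

Lemma rmorph_det_hmx (S S' : comNzRingType) (f : {rmorphism S -> S'}) a b i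
    (nu : 'I_i -> nat) :
  (forall t, f (a t) = b t) -> f (\det (hmx a nu)) = \det (hmx b nu).
Proof.
by move=> E; rewrite -det_map_mx map_hmx (eq_hmx nu (b := b)).
Qed.

Section Recurrence.
Variables (S : comNzRingType) (i : nat) (a : nat -> S).
Hypotheses (a0 : a 0%N = 1) (ai : forall t, (i < t)%N -> a t = 0).

Lemma sconv_hs s m : sconv a (hs a ^~ s) m = (m == s)%:R.
Proof.
rewrite sconvC /sconv; case: (ltnP m s) => lms.
  rewrite (ltn_eqF lms) big1 // => -[t lt] _.
  by rewrite /hs /= ifF ?mul0r //; apply/negbTE; rewrite -ltnNge; lia.
have -> : m.+1 = (s + (m - s).+1)%N by lia.
rewrite big_split_ord /= big1 ?add0r; last first.
  by move=> [t lt] _; rewrite /hs /= ifF ?mul0r //; lia.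
have := sconv_sdiv (fun m => (m == 0%N)%:R) (m - s) a0.
rewrite sconvC /sconv subn_eq0.
have -> : (m <= s)%N = (m == s) by lia.
move=> <-; apply: eq_bigr => -[t lt] _ /=.
by rewrite /hs leq_addr addKn; congr (_ * a _); lia.
Qed.

(** The recurrence makes the series [a * u] a polynomial of degree less than [i]; divide it by [a],
    noting that [hs a ^~ s] is the series [y^s / a]. *)
Lemma recur_expand u m : recur i a u ->
  u m = \sum_(s < i) hs a m s * sconv a u s.
Proof.
move=> ru; pose w m := \sum_(s < i) hs a m s * sconv a u s.
apply: (@sconv_inj _ a u w m.+1) => // {}m _.
have -> : sconv a w m = \sum_(s < i) (m == s)%:R * sconv a u s.
  rewrite /sconv /w; under eq_bigr => t _ do rewrite mulr_sumr.
  rewrite exchange_big /=; apply: eq_bigr => s _.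
  by rewrite -sconv_hs /sconv mulr_suml; apply: eq_bigr => t _; rewrite mulrA.
case: (ltnP m i) => lmi.
  rewrite (bigD1 (Ordinal lmi)) //= eqxx mul1r big1 ?addr0 // => s ns.
  by rewrite -val_eqE /= eq_sym in ns; rewrite (negbTE ns) mul0r.
rewrite big1; last first.
  by move=> [s ls] _ /=; rewrite (_ : (m == s) = false) ?mul0r //; lia.
have := ru (m - i)%N; rewrite subnK // => <-.
rewrite /sconv (_ : m.+1 = i.+1 + (m - i))%N; last by lia.
rewrite big_split_ord /= [X in _ + X]big1 ?addr0 // => t _.
by rewrite ai ?mul0r //=; lia.
Qed.

(** By [recur_expand] the matrix factors as [hmx a nu], a unitriangular matrix [L] of coefficients
    of [a], and the matrix of initial values. This is applied both to powers of the [z l] and to the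
    Hankel matrix of the [r]'s. *)
Lemma det_recur (u : 'I_i -> nat -> S) (nu : 'I_i -> nat) :
    (forall l, recur i a (u l)) ->
  \det (\matrix_(k, l) u l (nu k)) =
    \det (hmx a nu) * \det (\matrix_(k < i, l < i) u l k).
Proof.
move=> ru; pose L := \matrix_(s < i, t < i) (if (t <= s)%N then a (s - t)%N else 0).
have dL : \det L = 1.
  rewrite det_trig; last first.
    by apply/is_trig_mxP => s t lt; rewrite mxE leqNgt lt.
  by rewrite big1 // => s _; rewrite mxE leqnn subnn.
rewrite -[\det (\matrix_(_, _) u _ (nat_of_ord _))]mul1r -dL -!det_mulmx.
congr (\det _); apply/matrixP => k l; rewrite mxE (recur_expand _ (ru l)) mxE.
apply: eq_bigr => s _; rewrite !mxE; congr (_ * _).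
rewrite sconvC /sconv (big_ord_widen i (fun t => u l t * a (s - t)%N)) //.
rewrite big_mkcond /=; apply: eq_bigr => t _; rewrite !mxE ltnS mulrC.
by case: leqP; rewrite ?mul0r ?mulr0.
Qed.

End Recurrence.

(** * Alternants *)

Lemma mpoly_hom_ext (R S : comNzRingType) n (f g : {rmorphism {mpoly R[n]} -> S}) :
  (forall c, f c%:MP = g c%:MP) -> (forall l, f 'X_l = g 'X_l) -> f =1 g.
Proof.
move=> EC EX p; rewrite [p]mpolyE !rmorph_sum; apply: eq_bigr => m _.
rewrite -mul_mpolyC !rmorphM EC; congr (_ * _).
rewrite mpolyXE_id !rmorph_prod; apply: eq_bigr => l _.
by rewrite !rmorphXn EX.
Qed.

(* [evar R n] is the sequence 1, X_0, ..., X_(n-1), 0, 0, ... *)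
Definition evar (R : comNzRingType) n (k : nat) : {mpoly R[n]} :=
  if k is k'.+1 then (if insub k' is Some o then 'X_o else 0) else 1.

Lemma evarS (R : comNzRingType) n (o : 'I_n) : evar R n o.+1 = 'X_o.
Proof. by rewrite /evar insubT ?ltn_ord // => H; congr 'X_(_); apply: val_inj. Qed.

Lemma evar_gt (R : comNzRingType) n k : (n < k)%N -> evar R n k = 0.
Proof. by case: k => // k lk; rewrite /evar insubF //; apply/negbTE; rewrite -leqNgt. Qed.

Lemma mmap_evar (R S : comNzRingType) n (f : {rmorphism R -> S}) (e : nat -> S) k :
  e 0%N = 1 -> (forall k, (n < k)%N -> e k = 0) ->
  mmap f (fun o : 'I_n => e o.+1) (evar R n k) = e k.
Proof.
move=> e0 en; case: k => [|k]; first by rewrite rmorph1 e0.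
case: (ltnP k n) => lk; last by rewrite evar_gt // rmorph0 en.
by rewrite (evarS R (Ordinal lk)) mmapX mmap1U.
Qed.

Section Alternants.
Variables (F : fieldType) (i : nat).
Local Notation MZ := {mpoly F[i]}.
Let z (l : 'I_i) : MZ := 'X_l.

(* The coefficients of [\prod_l (1 - z_l y)]. *)
Definition zcoef k : MZ := (-1) ^+ k * esy z k.
(** Splits [A] into linear factors: its coefficients become signed elementary symmetric polynomials
    of the reciprocal roots [z]. *)
Definition zsub : MZ -> MZ := mmap (@mpolyC i F) (fun o : 'I_i => zcoef o.+1).
HB.instance Definition _ := GRing.RMorphism.on zsub.

Definition altmx (nu : 'I_i -> nat) : 'M[MZ]_i := \matrix_(k, l) z l ^+ nu k.
Definition valt : MZ := \det (altmx (@nat_of_ord i)).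

Lemma zcoef0 : zcoef 0 = 1.
Proof. by rewrite /zcoef esy0 mul1r. Qed.

Lemma zcoef_gt k : (i < k)%N -> zcoef k = 0.
Proof. by move=> lk; rewrite /zcoef esy_gt ?mulr0. Qed.

Lemma zsub_evar k : zsub (evar F i k) = zcoef k.
Proof. exact: mmap_evar zcoef0 zcoef_gt. Qed.

Lemma recur_power l : recur i zcoef (fun m => z l ^+ m).
Proof.
move=> m; have := prod_esy z (-1) (z l); rewrite (bigD1 l) //= mulN1r subrr mul0r.
move=> /(congr1 ( *%R (z l ^+ m))); rewrite mulr0 mulr_sumr => E; apply: etrans (esym E).
apply: eq_bigr => -[t lt] _ /=; rewrite -addnBA ?exprD; last by lia.
by rewrite /zcoef; ring.
Qed.

(** Jacobi's bialternant formula, obtained from [det_recur]; the initial values form the Vandermonde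
    determinant [valt]. *)
Lemma det_altmx nu : \det (altmx nu) = zsub (\det (hmx (evar F i) nu)) * valt.
Proof.
have -> : zsub (\det (hmx (evar F i) nu)) = \det (hmx zcoef nu).
  by apply: (rmorph_det_hmx (f := zsub)); apply: zsub_evar.
exact: (det_recur zcoef0 zcoef_gt nu recur_power).
Qed.

(** Up to the involution [sg], which changes signs of variables, [zsub] is evaluation at the
    elementary symmetric polynomials, which are algebraically independent. *)
Lemma zsub_inj : injective zsub.
Proof.
pose sg := mmap (@mpolyC i F) (fun o : 'I_i => (-1) ^+ o.+1 * 'X_o : MZ).
pose S := [tuple mesym i F k.+1 | k < i].
have sgK : cancel sg sg.
  move=> p; apply: (@mpoly_hom_ext _ _ _ (sg \o sg) idfun) => [c|l] /=.
    by rewrite /sg !mmapC.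
  rewrite /sg mmapX mmap1U rmorphM rmorphXn rmorphN1 /= mmapX mmap1U.
  by rewrite mulrA -exprD -signr_odd addnn odd_double mul1r.
have zE p : zsub p = sg p \mPo S.
  apply: (@mpoly_hom_ext _ _ _ zsub (comp_mpoly S \o sg)) => [c|l] /=.
    by rewrite /zsub /sg !mmapC comp_mpolyC.
  rewrite /zsub /sg !mmapX !mmap1U rmorphM rmorphXn rmorphN1 /=; congr (_ * _).
  by rewrite comp_mpolyXU -tnth_nth tnth_mktuple.
by move=> p q; rewrite !zE => /msym_fundamental_un /(can_inj sgK).
Qed.

Lemma det_altmxE nu :
  \det (altmx nu) = \sum_(s : 'S_i) (-1) ^+ s * 'X_[[multinom nu ((s^-1)%g l) | l < i]].
Proof.
apply: eq_bigr => s _; congr (_ * _); rewrite (mpolyXE _ s).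
by apply: eq_bigr => k _; rewrite !mxE mnmE permK.
Qed.

Definition incr (nu : 'I_i -> nat) := forall k l : 'I_i, (k < l)%N -> (nu k < nu l)%N.

Lemma perm_incr (s : 'S_i) : incr (fun k => s k) -> s = 1%g.
Proof.
have ge (t : 'S_i) : incr (fun k => t k) -> forall k : 'I_i, (k <= t k)%N.
  move=> it [k lk]; elim: k lk => // k IH lk /=.
  by apply: leq_ltn_trans (IH (ltnW lk)) _; apply: it.
move=> si; have si' : incr (fun k => (s^-1)%g k).
  move=> k l lkl; rewrite ltnNge leq_eqVlt; apply/norP; split.
    apply/negP => /eqP /val_inj /perm_inj E; by rewrite E ltnn in lkl.
  apply/negP => /si; rewrite !permKV; lia.
apply/permP => k; rewrite perm1; apply: val_inj; apply/eqP.
by rewrite eqn_leq ge // andbT; have := ge _ si' (s k); rewrite permK.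
Qed.

Lemma incr_le_inv nu k l : incr nu -> (nu k < nu l)%N -> (k < l)%N.
Proof.
move=> inu; apply: contraTT; rewrite -!leqNgt leq_eqVlt => /orP[/eqP/val_inj->//|].
by move/inu/ltnW.
Qed.

(** Among the rearrangements of an increasing exponent only the one by the identity is
    increasing. *)
Lemma coef_det_altmx nu nu' : incr nu -> incr nu' ->
  (\det (altmx nu))@_[multinom nu' l | l < i] = [forall l, nu l == nu' l]%:R.
Proof.
move=> inu inu'; rewrite det_altmxE raddf_sum /= (bigD1 1%g) //= big1 ?addr0.
  rewrite odd_perm1 mul1r mcoeffX; congr _%:R; congr nat_of_bool.
  apply/eqP/forallP => [/mnmP E l|E]; last first.
    by apply/mnmP => l; rewrite !mnmE invg1 perm1; apply/eqP.
  by have := E l; rewrite !mnmE invg1 perm1 => ->.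
move=> s ns; rewrite -(rmorph_sign (@mpolyC i F)) mul_mpolyC mcoeffZ mcoeffX.
case: eqP => [/mnmP E|]; rewrite ?mulr0 //; case/eqP: ns.
apply/invg_inj; rewrite invg1; apply: perm_incr => k l lkl.
apply: (incr_le_inv inu); have := E k; have := E l; rewrite !mnmE => -> ->.
exact: inu'.
Qed.

Lemma valt_neq0 : valt != 0.
Proof.
have io : incr (@nat_of_ord i) by [].
apply/eqP => E; have := coef_det_altmx io io; rewrite -/valt E mcoeff0.
by rewrite (_ : [forall _, _]) ?(introT forallP) // => /esym/eqP; rewrite oner_eq0.
Qed.

Lemma msym_valt (s : 'S_i) : msym s valt = (-1) ^+ s * valt.
Proof.
rewrite /valt -det_map_mx (_ : map_mx _ _ = col_perm s (altmx (@nat_of_ord i))).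
  by rewrite col_permE det_mulmx det_perm odd_permV mulrC.
apply/matrixP => k l; rewrite !mxE rmorphXn /z; congr (_ ^+ _).
by rewrite /= /msym mmapX mmap1U.
Qed.

Lemma zsub_sym p (s : 'S_i) : msym s (zsub p) = zsub p.
Proof.
apply: (@mpoly_hom_ext _ _ _ (msym s \o zsub) zsub) => [c|l] /=.
  by rewrite /zsub mmapC [LHS]mmapC.
rewrite /zsub mmapX mmap1U /zcoef rmorphM rmorphXn rmorphN1 /=; congr (_ * _).
by rewrite -mesymE_esy (issymP _ (mesym_sym _ _ _)).
Qed.

(** The product [valt * zsub p] is alternating, so [i!] times it is its own antisymmetrisation, a
    combination of alternants. By [det_altmx] each is [valt] times the image of a Jacobi-Trudi
    determinant; cancel [valt], [i!] and [zsub]. *)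
Lemma det_hmx_span (p : MZ) : [pchar F] =i pred0 ->
  lspan (fun v => exists nu : 'I_i -> nat, v = \det (hmx (evar F i) nu)) p.
Proof.
move=> F0; pose f := valt * zsub p.
have fE : i`!%:R *: f = \sum_(m <- msupp f) f@_m *: \det (altmx m).
  have -> : i`!%:R *: f = \sum_(s : 'S_i) (-1) ^+ s * msym s f.
    rewrite (eq_bigr (fun=> f)) => [|s _]; last first.
      by rewrite /f msymM msym_valt zsub_sym !mulrA -expr2 sqrr_sign mul1r.
    by rewrite sumr_const card_Sn scaler_nat.
  under eq_bigr => s _ do rewrite {1}[f]mpolyE raddf_sum mulr_sumr.
  rewrite exchange_big /=; apply: eq_bigr => m _; rewrite scaler_sumr.
  apply: eq_bigr => s _; rewrite /= msymZ -scalerAr; congr (_ *: (_ * _)).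
  rewrite /msym mmapX; apply: eq_bigr => k _; by rewrite !mxE.
have nz : (i`!%:R : F) != 0 by move/pcharf0P: F0 => ->; rewrite -lt0n fact_gt0.
have -> : p = \sum_(m <- msupp f) (f@_m / i`!%:R) *: \det (hmx (evar F i) m).
  apply: zsub_inj; apply: (mulfI valt_neq0); apply: (scalerI nz).
  rewrite -/f fE raddf_sum mulr_sumr scaler_sumr; apply: eq_bigr => m _.
  rewrite /= /zsub mmapZ mul_mpolyC -/zsub det_altmx -scalerAr scalerA mulrCA mulfV //.
  by rewrite mulr1 mulrC.
by apply: lspan_sum => m _; apply: lspan_scale; apply: lspan_mem; exists m.
Qed.

End Alternants.

(** * Products of complete symmetric polynomials *)

(** A maximiser of the sum exists and has no inversion, since undoing one by a transposition would
    increase the sum; hence the identity is the only maximiser. *)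
Lemma perm_rearrange i (nu : 'I_i -> nat) (s : 'S_i) : incr nu -> s != 1%g ->
  (\sum_k nu k * s k < \sum_k nu k * k)%N.
Proof.
move=> inu; pose f (t : 'S_i) := (\sum_k nu k * t k)%N.
have f1 : (\sum_k nu k * k)%N = f 1%g by apply: eq_bigr => k _; rewrite perm1.
rewrite f1 -/(f s).
have maxi t : (forall t', (f t' <= f t)%N) -> t = 1%g.
  move=> mt; apply: perm_incr => k l lkl; rewrite ltnNge; apply/negP => le.
  have {}le : (t l < t k)%N.
    rewrite ltn_neqAle le andbT; apply/eqP => /val_inj/perm_inj E.
    by rewrite E ltnn in lkl.
  have nkl : l != k by rewrite -val_eqE /= gtn_eqF.
  have := mt (tperm k l * t)%g; rewrite /f (bigD1 k) //= (bigD1 l) //=.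
  rewrite [leqRHS](bigD1 k) //= [X in (_ <= _ + X)%N](bigD1 l) //=.
  rewrite (eq_bigr (fun m => nu m * t m)%N) => [|m /andP[mk ml]]; last first.
    by rewrite permM tpermD // eq_sym.
  by rewrite !permM tpermL tpermR; have := inu _ _ lkl; nia.
have [t mt] : exists t, forall t', (f t' <= f t)%N.
  exists [arg max_(t > 1%g) f t]; case: arg_maxnP => // t _ H t'; exact: H.
have t1 := maxi t mt; rewrite {}t1 in mt.
move=> ns; rewrite ltn_neqAle mt andbT; apply: contra ns => /eqP E.
by apply/eqP/maxi => t'; rewrite E.
Qed.

Section HProducts.
Variables (F : fieldType) (i : nat).
Local Notation MZ := {mpoly F[i]}.
Implicit Types t : seq nat.

Definition hprod t : MZ := \prod_(m <- t) hser (evar F i) m.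
Let nrm t := (\sum_(m <- t) m ^ 2)%N.
Let nuof t (k : 'I_i) := (nth 0 t k + k)%N.
(** The coordinate of [p] along the Jacobi-Trudi determinant of [t], for sorted [t]: [det_altmx] and
    [coef_det_altmx] give the duality. *)
Let cf t (p : MZ) := (valt F i * zsub p)@_[multinom nuof t l | l < i].

Lemma nuof_incr t : size t = i -> sorted leq t -> incr (nuof t).
Proof.
move=> st so k l lkl; rewrite /nuof -addnS leq_add //.
by apply: (sorted_leq_nth leq_trans leqnn) => //; rewrite ?inE ?st // ltnW.
Qed.

Lemma nuof_inj t t' : size t = i -> size t' = i -> nuof t =1 nuof t' -> t = t'.
Proof.
move=> st st' E; apply: (@eq_from_nth _ 0%N); rewrite ?st // => k lk.
by have /addIn := E (Ordinal lk).
Qed.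

Lemma cf_sum t (I : Type) (s : seq I) (c : I -> F) (f : I -> MZ) :
  cf t (\sum_(x <- s) c x *: f x) = \sum_(x <- s) c x * cf t (f x).
Proof.
rewrite /cf raddf_sum mulr_sumr raddf_sum; apply: eq_bigr => x _.
by rewrite /= /zsub mmapZ mul_mpolyC -scalerAr mcoeffZ.
Qed.

Lemma nrm_le t : (nrm t <= sumn t ^ 2)%N.
Proof.
rewrite /nrm; elim: t => [|m t IH]; first by rewrite big_nil.
rewrite big_cons /= sqrnD; nia.
Qed.

(* In the Jacobi-Trudi determinant of [t] the identity permutation contributes
   [hprod t] and, by the rearrangement inequality, every other one a product
   with the same sum and a larger sum of squares: descending induction on the
   sum of squares. *)
Lemma cf_hprod t t' :
    size t = i -> size t' = i -> sorted leq t -> sorted leq t' ->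
  (nrm t' <= nrm t)%N -> cf t' (hprod t) = (t == t')%:R.
Proof.
move=> st st' so so'; move EN: (sumn t ^ 2 - nrm t)%N => N le.
elim/ltn_ind: N t EN st so le => N IH t EN st so le.
have <- : cf t' (\det (hmx (evar F i) (nuof t))) = (t == t')%:R.
  rewrite /cf mulrC -det_altmx coef_det_altmx; try exact: nuof_incr.
  congr (nat_of_bool _)%:R; apply/forallP/eqP => [E|-> //].
  by apply: nuof_inj => // k; apply/eqP.
(* The right side does not depend on [s], so a smaller scalar product with [nuof t] means a larger
   sum of squares of the indices [nuof t k - s k]. *)
have sub_sum (s : 'S_i) : (forall k, (s k <= nuof t k)%N) ->
    (\sum_k (nuof t k - s k) ^ 2 + 2 * \sum_k nuof t k * s k =
      \sum_k nuof t k ^ 2 + \sum_(k < i) k ^ 2)%N.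
  move=> lts; rewrite [X in (_ = _ + X)%N](reindex_inj (@perm_inj _ s)) /=.
  rewrite big_distrr -!big_split /=; apply: eq_bigr => k _.
  by have := lts k; nia.
have tE (g : nat -> nat) : (\sum_(m <- t) g m = \sum_(k < i) g (nuof t k - k))%N.
  by rewrite (big_nth 0%N) st big_mkord; apply: eq_bigr => k _; rewrite addnK.
have -> : \det (hmx (evar F i) (nuof t)) =
    \sum_(s : 'S_i) ((-1) ^+ s : F) *: \prod_k hs (evar F i) (nuof t k) (s k).
  apply: eq_bigr => s _; rewrite -mul_mpolyC rmorph_sign; congr (_ * _).
  by apply: eq_bigr => k _; rewrite mxE.
rewrite cf_sum (bigD1 1%g) //= odd_perm1 mul1r [X in _ + X]big1 ?addr0.
  congr (cf t' _); rewrite /hprod (big_nth 0%N) st big_mkord; apply: eq_bigr => k _.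
  by rewrite perm1 /hs leq_addl addnK.
move=> s ns; case: (boolP [forall k, s k <= nuof t k]%N) => [/forallP lts|]; last first.
  rewrite negb_forall => /existsP[k nk]; rewrite (bigD1 k) //= /hs (negbTE nk).
  by rewrite mul0r /cf rmorph0 mulr0 mcoeff0 mulr0.
pose tt := [seq (nuof t k - s k)%N | k <- enum 'I_i].
have ttE (R : Type) (idx : R) (op : Monoid.com_law idx) (g : nat -> R) :
    \big[op/idx]_(m <- sort leq tt) g m = \big[op/idx]_k g (nuof t k - s k)%N.
  rewrite (perm_big tt) ?perm_sort // /tt big_map.
  by rewrite big_enum.
have -> : \prod_k hs (evar F i) (nuof t k) (s k) = hprod (sort leq tt).
  by rewrite /hprod ttE; apply: eq_bigr => k _; rewrite /hs lts.
have snE : sumn (sort leq tt) = sumn t.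
  have sumnB (r : 'S_i) : (forall k, (r k <= nuof t k)%N) ->
    (\sum_k (nuof t k - r k) + \sum_(k < i) k = \sum_k nuof t k)%N.
    move=> lr; rewrite [X in (_ + X)%N](reindex_inj (@perm_inj _ r)) -big_split.
    by apply: eq_bigr => k _ /=; rewrite subnK.
  rewrite !sumnE ttE tE.
  apply: (@addIn (\sum_(k < i) k)%N); rewrite sumnB // -(sumnB 1%g) => [|k].
    by congr (_ + _)%N; apply: eq_bigr => k _; rewrite perm1.
  by rewrite perm1 leq_addl.
have ltn : (nrm t < nrm (sort leq tt))%N.
  have := perm_rearrange (nuof_incr st so) ns.
  have := sub_sum s lts; have : forall k, ((1%g : 'S_i) k <= nuof t k)%N.
    by move=> k; rewrite perm1 leq_addl.
  move/sub_sum; rewrite /nrm ttE (tE (fun m => m ^ 2)%N).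
  rewrite (eq_bigr (fun k : 'I_i => (nuof t k - k) ^ 2)%N) => [|k _]; last by rewrite perm1.
  rewrite [X in (_ + 2 * X)%N](eq_bigr (fun k : 'I_i => nuof t k * k)%N) => [|k _]; last by rewrite perm1.
  have aux a b c d e : (a + 2 * b = c -> d + 2 * e = c -> e < b -> a < d)%N by lia.
  exact: aux.
have stt : size (sort leq tt) = i by rewrite size_sort size_map size_enum_ord.
rewrite (IH (sumn t ^ 2 - nrm (sort leq tt))%N) ?snE //.
- rewrite (_ : _ == t' = false) ?mulr0 //; apply/eqP => E.
  by rewrite E ltnNge le in ltn.
- by have := nrm_le (sort leq tt); rewrite snE -EN; lia.
- by apply: sort_sorted; apply: leq_total.
- exact: leq_trans le (ltnW ltn).
Qed.

(** Among the indices with nonzero coefficient take [y] with the least sum of squares: by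
    [cf_hprod], [cf (t y)] kills all the other terms. *)
Lemma hprod_indep (I : eqType) (s : seq I) (t : I -> seq nat) (c : I -> F) :
    uniq s -> {in s &, injective t} ->
    (forall x, x \in s -> size (t x) = i /\ sorted leq (t x)) ->
    \sum_(x <- s) c x *: hprod (t x) = 0 ->
  forall x, x \in s -> c x = 0.
Proof.
move=> us injt ts E0 x xs; apply/eqP; apply: contraTT isT => nz.
pose P y := (y \in s) && (c y != 0).
have [y /andP[ys ny] ym] : exists2 y, P y & forall x, P x -> (nrm (t y) <= nrm (t x))%N.
  have [N] := ubnP (nrm (t x)); have : P x by rewrite /P xs.
  elim: N x {xs nz} => // N IH x Px; rewrite ltnS => lN.
  case: (boolP (has (fun y => (c y != 0) && (nrm (t y) < nrm (t x))%N) s)) => [/hasP[y ys /andP[cy ly]]|].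
    by apply: (IH y); rewrite /P ?ys //; apply: leq_trans lN.
  move=> /hasPn H; exists x => // y /andP[ys cy].
  by have := H y ys; rewrite cy /= -leqNgt.
have [sty soy] := ts y ys.
have := cf_sum (t y) s c (fun x => hprod (t x)); rewrite E0 {1}/cf rmorph0 mulr0 mcoeff0.
rewrite (bigD1_seq y) //= cf_hprod // eqxx mulr1 big_seq_cond big1.
  by rewrite addr0 => /esym/eqP; rewrite (negbTE ny).
move=> w /andP[ws nw]; have [->|cw] := eqVneq (c w) 0; first by rewrite mul0r.
have [stw sow] := ts w ws.
rewrite cf_hprod ?ym /P ?ws // (_ : _ == _ = false) ?mulr0 //.
by apply/eqP => /injt E; case/eqP: nw; apply: E.
Qed.

End HProducts.

(** * Leading coefficients *)

(** Independence from leading parts. Let [y] have the greatest weight among the indices with nonzero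
    coefficient. Then [C (key y)] sees only terms with the key of [y], through their leading parts
    [g], so only families with one common key remain to be treated. *)
Lemma indep_lead (F : fieldType) (V W : lmodType F) (I T : eqType) (s : seq I)
    (a : I -> F) (f : I -> V) (g : I -> W) (key : I -> T) (wt : T -> nat)
    (C : T -> V -> W) :
  (forall t c u v, C t (c *: u + v) = c *: C t u + C t v) ->
  {in s &, forall x y, (wt (key x) <= wt (key y))%N ->
     C (key y) (f x) = if key x == key y then g x else 0} ->
  {in s, forall y, \sum_(x <- s | key x == key y) a x *: g x = 0 -> a y = 0} ->
  \sum_(x <- s) a x *: f x = 0 -> {in s, forall x, a x = 0}.
Proof.
move=> lC Cf H E0 x xs; apply/eqP; apply: contraTT isT => nz.
have C0 t : C t 0 = 0 by have := lC t (-1) 0 0; rewrite scaler0 addr0 scaleN1r addNr.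
have CS t (r : seq I) : C t (\sum_(x <- r) a x *: f x) = \sum_(x <- r) a x *: C t (f x).
  by elim: r => [|y r IH]; rewrite ?big_nil // !big_cons lC IH.
pose m := \max_(y <- s | a y != 0) wt (key y).
have [y ys /andP[ny /eqP my]] : exists2 y, y \in s & (a y != 0) && (wt (key y) == m).
  apply/hasP; apply: contraTT isT => /hasPn Hn.
  have lt y : y \in s -> a y != 0 -> (wt (key y) < m)%N.
    move=> ys ny; have := Hn y ys; rewrite ny /= ltn_neqAle => ->.
    exact: leq_bigmax_seq.
  have := lt x xs nz; rewrite ltnNge => /negP; case.
  have m0 : (0 < m)%N by apply: leq_ltn_trans (lt x xs nz).
  suff : (m <= m.-1)%N by move: m0; case: (m) => // k _; rewrite /= ltnn.
  by apply/bigmax_leqP_seq => z zs nz'; have := lt z zs nz'; lia.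
have := CS (key y) s; rewrite E0 C0 => /esym E.
suff /H Hy : \sum_(x <- s | key x == key y) a x *: g x = 0 by rewrite Hy ?eqxx in ny.
rewrite -[RHS]E big_mkcond /= !big_seq; apply: eq_bigr => z zs.
have [->|cz] := eqVneq (a z) 0; first by rewrite !scale0r if_same.
rewrite Cf //; first by case: ifP; rewrite ?scaler0.
by rewrite my; apply: leq_bigmax_seq.
Qed.

Section Lead.
Variable K : comNzRingType.
Implicit Types p q : {poly K}.

(** The coefficient [c] may be 0, so [d] only bounds the degree and products cause no trouble over a
    ring with zero divisors. *)
Definition lead d c p := (size p <= d.+1)%N /\ p`_d = c.

Lemma lead_coef_ge d d' c p : lead d c p -> (d <= d')%N ->
  p`_d' = if d == d' then c else 0.
Proof.
move=> [sp <-] le; case: eqP => [->//|ne]; apply: nth_default.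
by apply: leq_trans sp _; lia.
Qed.

Lemma leadM d c p d' c' p' : lead d c p -> lead d' c' p' ->
  lead (d + d') (c * c') (p * p').
Proof.
move=> lp lp'; split.
  by have [? _] := lp; have [? _] := lp'; apply: leq_trans (size_mul_leq _ _) _; lia.
have ld : (d < (d + d').+1)%N by rewrite ltnS leq_addr.
rewrite coefM (bigD1 (Ordinal ld)) //= big1 ?addr0.
  by rewrite addKn; have [_ ->] := lp; have [_ ->] := lp'.
move=> [t lt]; rewrite -val_eqE /= => nt; case: (leqP d t) => ldt.
  by rewrite (lead_coef_ge lp ldt) eq_sym (negbTE nt) mul0r.
rewrite (lead_coef_ge (d' := d + d' - t) lp'); last by lia.
by rewrite ifF ?mulr0 //; lia.
Qed.

Lemma lead1 : lead 0 1 1.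
Proof. by split; rewrite ?size_poly1 // coefC. Qed.

Lemma coef_CXn d (c : K) k : (c%:P * 'X^d)`_k = if k == d then c else 0.
Proof. by rewrite coefCM coefXn; case: eqP => _; rewrite ?mulr1 ?mulr0. Qed.

Lemma lead_CXn d c : lead d c (c%:P * 'X^d).
Proof.
split; last by rewrite coef_CXn eqxx.
by rewrite mul_polyC; apply: leq_trans (size_scale_leq _ _) _; rewrite size_polyXn.
Qed.

Lemma leadX d c p k : lead d c p -> lead (d * k) (c ^+ k) (p ^+ k).
Proof.
move=> lp; elim: k => [|k IH]; first by rewrite muln0; apply: lead1.
by rewrite !exprS mulnS; apply: leadM.
Qed.

Lemma lead_prod (I : eqType) (r : seq I) (d : I -> nat) (c : I -> K) (p : I -> {poly K}) :
  {in r, forall x, lead (d x) (c x) (p x)} ->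
  lead (\sum_(x <- r) d x)%N (\prod_(x <- r) c x) (\prod_(x <- r) p x).
Proof.
elim: r => [|x r IH] H; first by rewrite !big_nil; apply: lead1.
rewrite !big_cons; apply: leadM; first by apply: H; rewrite mem_head.
by apply: IH => y yr; apply: H; rewrite inE yr orbT.
Qed.

Lemma lead_sumB (I : Type) (r : seq I) p (f : I -> {poly K}) d c :
  lead d c p -> (forall x, (size (f x) <= d)%N) -> lead d c (p + \sum_(x <- r) f x).
Proof.
move=> [sp cp] H.
have sf : (size (\sum_(x <- r) f x)%R <= d)%N.
  apply: (big_ind (fun q => (size q <= d)%N)) => [|p1 p2 ? ?|x _] //.
    by rewrite size_poly0.
  by rewrite (leq_trans (size_polyD _ _)) // geq_max; apply/andP.
split; last by rewrite coefD cp (nth_default _ sf) addr0.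
rewrite (leq_trans (size_polyD _ _)) // geq_max sp /=; exact: leqW.
Qed.

End Lead.

Section Grading.
Variables (K : comNzRingType) (e : nat -> K).
Hypothesis e0 : e 0%N = 1.
Let e' k := (e k)%:P * 'X^(k./2).

Lemma rser_graded m : rser e' m = (rser e m)%:P * 'X^m.
Proof.
symmetry; apply: (@sdiv_uniq _ _ _ (fun m => (rser e m)%:P * 'X^m) m.+1) => //.
  by rewrite /e' e0 mul1r.
move=> k _; rewrite /e' (_ : (2 * k + 1)./2 = k); last by lia.
rewrite -sconv_rser // rmorph_sum mulr_suml.
apply: eq_bigr => -[t lt] _ /=; rewrite rmorphM mulrACA -exprD.
by congr (_ * 'X^_); lia.
Qed.

(** In [pserE] the products of two [r]'s and a [p] have total index [m - 1], so only the first term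
    reaches weight [m]. *)
Lemma pser_graded m : lead m ((2 * m + 1)%:R * rser e m) (pser e' m).
Proof.
elim/ltn_ind: m => m IH; rewrite pserE rser_graded.
apply: lead_sumB => [|[t ltm]] /=.
  by rewrite mulrA -(rmorph_nat (@polyC K)) -polyCM; apply: lead_CXn.
have lc : lead t (sconv (rser e) (rser e) t) (sconv (rser e') (rser e') t).
  have -> : sconv (rser e') (rser e') t = (sconv (rser e) (rser e) t)%:P * 'X^t.
    rewrite rmorph_sum mulr_suml; apply: eq_bigr => -[u lu] _ /=.
    rewrite !rser_graded rmorphM mulrACA -exprD; congr (_ * 'X^_); lia.
  exact: lead_CXn.
have /IH lt : (m - t.+1 < m)%N by lia.
by have [sz _] := leadM lc lt; apply: leq_trans sz _; lia.
Qed.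

End Grading.

(** * Linear independence *)

Lemma jj_odd n m : (0 < n)%N -> (2 * m + 1 <= n)%N = (m <= jj n)%N.
Proof. rewrite /jj; lia. Qed.

Definition gprod (S : comNzRingType) n (q : nat -> S) (x : pp_index n) : S :=
  (\prod_(l < (jj n).+1) q l ^+ tnth x.1 l) * \prod_(m <- x.2) q m.

Lemma rmorph_gprod (S S' : comNzRingType) (f : {rmorphism S -> S'}) n q (x : pp_index n) :
  f (gprod q x) = gprod (f \o q) x.
Proof.
rewrite rmorphM !rmorph_prod; congr (_ * _).
by apply: eq_bigr => l _; rewrite rmorphXn.
Qed.

Lemma eq_gprod (S : comNzRingType) n (q q' : nat -> S) (x : pp_index n) :
  q =1 q' -> gprod q x = gprod q' x.
Proof.
move=> E; congr (_ * _); last by apply: eq_bigr => m _; rewrite E.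
by apply: eq_bigr => l _; rewrite E.
Qed.

Lemma gprodM (S : comNzRingType) n (q q' : nat -> S) (x : pp_index n) :
  gprod (fun m => q m * q' m) x = gprod q x * gprod q' x.
Proof.
rewrite /gprod mulrACA -!big_split; congr (_ * _).
by apply: eq_bigr => l _; rewrite exprMn.
Qed.

Lemma lead_gprod (K : comNzRingType) n (x : pp_index n) (q : nat -> {poly K})
    (d d' : nat -> nat) (c c' : nat -> K) :
  (forall l, (l <= jj n)%N -> lead (d l) (c l) (q l)) ->
  {in x.2, forall m, lead (d' m) (c' m) (q m)} ->
  lead (\sum_(l < (jj n).+1) d l * tnth x.1 l + \sum_(m <- x.2) d' m)%N
    ((\prod_(l < (jj n).+1) c l ^+ tnth x.1 l) * \prod_(m <- x.2) c' m)
    (gprod q x).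
Proof.
move=> Hl Hm; apply: leadM; last exact: lead_prod.
by apply: lead_prod => l _; apply: leadX; apply: Hl; rewrite -ltnS.
Qed.

Section Independence.
Variables (K : comNzRingType) (n : nat) (a X : nat -> K).
Hypotheses (n0 : (0 < n)%N) (a0 : a 0%N = 1) (an : forall k, (ii n < k)%N -> a k = 0).
Local Notation j := (jj n).

Let aP t : {poly K} := (a t)%:P.
Let rb m : {poly K} := (X m)%:P * 'X^m.

(* A specialisation of the elementary symmetric functions for which the first
   [j + 1] coefficients of [R] are [X_m u^m]. *)
Definition eeR k : {poly K} :=
  if odd k then if (k <= n)%N then sconv aP rb k./2 else 0 else aP k./2.

Lemma eeR0 : eeR 0 = 1.
Proof. by rewrite /eeR /aP a0. Qed.

Lemma eeR_gt k : (n < k)%N -> eeR k = 0.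
Proof.
move=> lk; rewrite /eeR; case: ifP => ok; first by rewrite leqNgt lk.
by rewrite /aP an ?polyC0 // /ii; lia.
Qed.

Lemma eeR_even t : eeR (2 * t) = aP t.
Proof. by rewrite /eeR oddM mul2n doubleK. Qed.

Lemma eeR_odd m : eeR (2 * m + 1) = if (m <= j)%N then sconv aP rb m else 0.
Proof.
rewrite /eeR oddD oddM /= jj_odd // (_ : (2 * m + 1)./2 = m) //; lia.
Qed.

Let rho m := rser eeR m.

Lemma sconv_rho m : sconv aP rho m = eeR (2 * m + 1).
Proof.
rewrite -(sconv_rser m eeR0); apply: eq_bigr => t _.
by rewrite eeR_even.
Qed.

(** Up to index [j] the odd entries of [eeR] are the untruncated product of [aP] and [rb]. *)
Lemma rho_small m : (m <= j)%N -> rho m = (X m)%:P * 'X^m.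
Proof.
have aP0 : aP 0 = 1 by rewrite /aP a0.
move=> lm; apply: (@sconv_inj _ aP rho rb j.+1) => // k lk.
by rewrite sconv_rho eeR_odd -ltnS lk.
Qed.

Lemma size_rho m : (size (rho m) <= j.+1)%N.
Proof.
elim/ltn_ind: m => m IH; have := sconv_rho m.
rewrite /sconv big_ord_recl {1}/aP a0 mul1r subn0 => /(canRL (addrK _)) ->.
have szM t (q : {poly K}) : (size (aP t * q)%R <= size q)%N.
  by rewrite /aP mul_polyC; apply: size_scale_leq.
have szS k (f : 'I_k -> {poly K}) : (forall t, size (f t) <= j.+1)%N ->
    (size (\sum_t f t)%R <= j.+1)%N.
  move=> H; apply: (big_ind (fun q : {poly K} => (size q <= j.+1)%N)) => //.
    by rewrite size_poly0.
  by move=> p q ? ?; rewrite (leq_trans (size_polyD _ _)) // geq_max; apply/andP.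
rewrite (leq_trans (size_polyD _ _)) // geq_max size_polyN; apply/andP; split.
  rewrite eeR_odd; case: (leqP m j) => lm; last by rewrite size_poly0.
  apply: szS => t; apply: leq_trans (szM _ _) _.
  rewrite /rb mul_polyC (leq_trans (size_scale_leq _ _)) // size_polyXn; lia.
apply: szS => -[t lt]; apply: leq_trans (szM _ _) _ => /=.
by rewrite /bump /=; apply: IH; lia.
Qed.

(** Take coefficients of [u^j] in [A R = B]. On the right only index [j] contributes, with [X j]; so
    they form the series [X_j y^j / A]. *)
Lemma lead_rho m : (j < m)%N -> lead j (X j * hser a (m - j)) (rho m).
Proof.
move=> lm; split; first exact: size_rho.
have E : forall k, (k < m.+1)%N -> (rho k)`_j = X j * hs a k j.
  apply: (@sconv_inj _ a _ (fun k => X j * hs a k j)) => // k _.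
  have -> : sconv a (fun k => X j * hs a k j) k = X j * (k == j)%:R.
    rewrite -(sconv_hs a0) mulr_sumr; apply: eq_bigr => t _.
    by rewrite mulrCA.
  have -> : sconv a (fun k => (rho k)`_j) k = (sconv aP rho k)`_j.
    by rewrite coef_sum; apply: eq_bigr => t _; rewrite coefCM.
  rewrite sconv_rho eeR_odd; case: (leqP k j) => lk; last first.
    by rewrite coef0 (gtn_eqF lk) mulr0.
  rewrite coef_sum big_ord_recl subn0 coefCM a0 mul1r /rb coefCM coefXn /= big1 ?addr0.
    by rewrite eq_sym; case: eqP => [->|]; rewrite ?mulr0.
  move=> -[t lt] _; rewrite !coefCM coefXn /= /bump /= gtn_eqF ?mulr0 //; lia.
by rewrite E // /hs ltnW.
Qed.

(** Each factor with [m > j] brings one more [X j], which explains the correction of the exponent at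
    [ord_max]. *)
Lemma lead_rser_prod (x : pp_index n) : pp_valid x ->
  lead (\sum_(l < j.+1) l * (tnth x.1 l + (l == ord_max) * size x.2))%N
    (\prod_(l < j.+1) X l ^+ (tnth x.1 l + (l == ord_max) * size x.2)
       * \prod_(m <- x.2) hser a (m - j)) (gprod rho x).
Proof.
move=> /and3P[_ /allP x2 _].
have := @lead_gprod K n x rho id (fun=> j) X (fun m => X j * hser a (m - j)).
have -> : (\sum_(l < j.+1) id l * tnth x.1 l + \sum_(m <- x.2) j =
    \sum_(l < j.+1) l * (tnth x.1 l + (l == ord_max) * size x.2))%N.
  under [RHS]eq_bigr => l _ do rewrite mulnDr.
  rewrite big_split /=; congr (_ + _)%N; rewrite big_const_seq count_predT iter_addn_0.
  rewrite (bigD1 ord_max) //= big1 ?addn0; first by rewrite eqxx mul1n.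
  by move=> l /negbTE->; rewrite mul0n muln0.
have -> : (\prod_(l < j.+1) X l ^+ tnth x.1 l) *
    (\prod_(m <- x.2) (X j * hser a (m - j))) =
    \prod_(l < j.+1) X l ^+ (tnth x.1 l + (l == ord_max) * size x.2)
       * \prod_(m <- x.2) hser a (m - j).
  rewrite big_split /= mulrA; congr (_ * _).
  under [RHS]eq_bigr => l _ do rewrite exprD.
  rewrite big_split /=; congr (_ * _).
  rewrite (bigD1 ord_max) //= [X in _ * X]big1 ?mulr1; last first.
    by move=> l /negbTE->; rewrite mul0n.
  by rewrite eqxx mul1n big_const_seq count_predT iter_mulr_1.
apply; last by move=> m /x2; apply: lead_rho.
by move=> l ll; rewrite rho_small //; apply: lead_CXn.
Qed.

End Independence.

(** Specialise by [eeR] with the coefficients of [A] and the [X_m], [m <= j], as independent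
    variables. The key of a product is the [X]-monomial of its leading part; terms sharing a key are
    separated by their products of [h]'s. *)
Lemma rser_prod_indep (F : fieldType) n (s : seq (pp_index n)) (c : pp_index n -> F) :
    (0 < n)%N -> uniq s -> all (@pp_valid n) s ->
    \sum_(x <- s) c x *: gprod (rser (evar F n)) x = 0 ->
  {in s, forall x, c x = 0}.
Proof.
move=> n0 us /allP vs.
set i := ii n; set j := jj n.
pose g := @polyC {mpoly {mpoly F[i]}[j.+1]} \o (@mpolyC j.+1 {mpoly F[i]} \o @mpolyC i F).
pose ev := eeR n (fun t => (evar F i t)%:MP) (fun m => evar {mpoly F[i]} j.+1 m.+1).
pose eta : {rmorphism {mpoly F[n]} -> {poly {mpoly {mpoly F[i]}[j.+1]}}} :=
  mmap g (fun o : 'I_n => ev o.+1).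
have eta_ev k : eta (evar F n k) = ev k.
  apply: mmap_evar; first exact: eeR0.
  by move=> {}k; apply: eeR_gt => // {}k /evar_gt ->; rewrite mpolyC0.
have etaC d : eta d%:MP = g d by apply: mmapC.
pose mn (x : pp_index n) : 'X_{1..j.+1} :=
  [multinom (tnth x.1 l + (l == ord_max) * size x.2)%N | l < j.+1].
pose wt (m : 'X_{1..j.+1}) := (\sum_(l < j.+1) l * m l)%N.
pose hx (x : pp_index n) : {mpoly F[i]} := \prod_(m <- x.2) hser (evar F i) (m - j).
have le_eta x : pp_valid x ->
    lead (wt (mn x)) ((hx x)%:MP * 'X_[mn x]) (eta (gprod (rser (evar F n)) x)).
  move=> vx; have := lead_rser_prod (fun m => evar {mpoly F[i]} j.+1 m.+1)
    n0 (erefl : (fun t => (evar F i t)%:MP_[j.+1]) 0%N = 1) vx.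
  rewrite -/j -/ev rmorph_gprod => H.
  rewrite (@eq_gprod _ _ _ (rser ev)); last first.
    by move=> m /=; rewrite rmorph_rser; apply: eq_rser; apply: eta_ev.
  move: H; congr lead.
    by apply: eq_bigr => l _; rewrite mnmE.
  rewrite mulrC /hx rmorph_prod; congr (_ * _).
    by apply: eq_bigr => m _; rewrite (rmorph_hser (@mpolyC j.+1 _)).
  rewrite mpolyXE_id; apply: eq_bigr => l _.
  by rewrite mnmE evarS.
pose C m (p : {mpoly F[n]}) : {mpoly F[i]} := ((eta p)`_(wt m))@_m.
apply: (@indep_lead F _ _ _ _ s c _ hx mn wt C).
- move=> m d u v; rewrite /C rmorphD coefD mcoeffD; congr (_ + _).
  by rewrite -mul_mpolyC rmorphM etaC coefCM mcoeffCM mul_mpolyC.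
- move=> x y xs ys le; have := lead_coef_ge (le_eta x (vs x xs)) le.
  rewrite /C => ->; have [E|nE] := eqVneq (mn x) (mn y).
    by rewrite E eqxx mcoeffCM mcoeffX eqxx mulr1.
  case: eqP => _; last by rewrite mcoeff0.
  by rewrite mcoeffCM mcoeffX (negbTE nE) mulr0.
move=> y ys E0.
(* Padding with [h_0 = 1] turns at most [i] factors into exactly [i]. *)
pose t (x : pp_index n) := nseq (i - size x.2) 0%N ++ [seq (m - j)%N | m <- x.2].
have tE x : hprod F i (t x) = hx x.
  rewrite /hprod big_cat /= big1_seq ?mul1r; last first.
    move=> m /andP[_]; rewrite mem_nseq => /andP[_ /eqP->].
    by rewrite /hser sdivE big_ord0 subr0.
  by rewrite big_map.
apply: (@hprod_indep F i _ [seq x <- s | mn x == mn y] t c).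
- exact: filter_uniq.
- move=> x x'; rewrite !mem_filter => /andP[/eqP Ex xs] /andP[/eqP Ex' xs'].
  have [/and3P[_ vx sx] /and3P[_ vx' sx']] := (vs x xs, vs x' xs').
  (* Since [m - j >= 1] for the genuine entries, dropping zeros removes exactly the padding and
     recovers [x.2]; the monomial then gives [x.1]. *)
  move=> /(congr1 (map (addn j) \o filter (leq 1))) /=; rewrite !filter_cat.
  have z k : filter (leq 1) (nseq k 0%N) = [::].
    by apply/eqP; rewrite -size_eq0 size_filter -leqn0 leqNgt -has_count has_nseq andbF.
  have nz (r : seq nat) : all (fun m => j < m)%N r ->
      map (addn j) (filter (leq 1) [seq (m - j)%N | m <- r]) = r.
    elim: r => //= m r IH /andP[lm /IH ar]; rewrite subn_gt0 lm /= ar.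
    by rewrite subnKC // ltnW.
  rewrite !z !nz // => E2.
  have E1 : x.1 = x'.1.
    apply: eq_from_tnth => l; have := Ex; rewrite -Ex' => /mnmP/(_ l).
    by rewrite !mnmE E2 => /addIn.
  by rewrite [x]surjective_pairing [x']surjective_pairing E1 E2.
- move=> x; rewrite mem_filter => /andP[_ xs]; have /and3P[so vx sx] := vs x xs.
  split; first by rewrite size_cat size_nseq size_map subnK.
  have : sorted leq [seq (m - j)%N | m <- x.2].
    by apply: homo_sorted so => m m' ?; apply: leq_sub2r.
  rewrite /t; elim: (i - _)%N => //= k IH so'; rewrite path_min_sorted ?IH //.
  by apply/allP.
- by rewrite big_filter -[RHS]E0; apply: eq_bigr => x _; rewrite tE.
by rewrite mem_filter eqxx.
Qed.

(** * The grading by total index and the passage to power sums *)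

Definition grade (F : fieldType) n : {rmorphism {mpoly F[n]} -> {poly {mpoly F[n]}}} :=
  mmap (@polyC {mpoly F[n]} \o @mpolyC n F)
    (fun o : 'I_n => (evar F n o.+1)%:P * 'X^(o.+1./2)).

Lemma grade_evar (F : fieldType) n k :
  grade F n (evar F n k) = (evar F n k)%:P * 'X^(k./2).
Proof.
apply: (@mmap_evar _ _ n _ (fun k => (evar F n k)%:P * 'X^(k./2))).
  by rewrite mul1r.
by move=> {}k lk; rewrite evar_gt // mul0r.
Qed.

Lemma gradeC (F : fieldType) n c : grade F n c%:MP = (c%:MP)%:P.
Proof. exact: mmapC. Qed.

Lemma grade_rser (F : fieldType) n m :
  grade F n (rser (evar F n) m) = (rser (evar F n) m)%:P * 'X^m.
Proof. by rewrite -rser_graded // rmorph_rser; apply: eq_rser; apply: grade_evar. Qed.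

(** For the grading the leading part of a product of [p]'s is the same product of [r]'s times a
    product of odd integers, nonzero in characteristic 0. *)
Lemma pser_prod_indep (F : fieldType) n (s : seq (pp_index n)) (c : pp_index n -> F) :
    [pchar F] =i pred0 -> (0 < n)%N -> uniq s -> all (@pp_valid n) s ->
    \sum_(x <- s) c x *: gprod (pser (evar F n)) x = 0 ->
  {in s, forall x, c x = 0}.
Proof.
move=> F0 n0 us vs; set e := evar F n; pose th := grade F n.
pose e' k := (e k)%:P * 'X^(k./2) : {poly {mpoly F[n]}}.
pose wt (x : pp_index n) := (\sum_(l < (jj n).+1) l * tnth x.1 l + \sum_(m <- x.2) m)%N.
pose k (x : pp_index n) : F := gprod (fun m => (2 * m + 1)%:R) x.
have kn0 x : k x != 0.
  have nz m : ((2 * m + 1)%:R : F) != 0 by move/pcharf0P: F0 => ->; rewrite addn1.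
  rewrite mulf_neq0 // prodf_seq_neq0; apply/allP => l _ //=.
  by rewrite expf_neq0.
have leth x : lead (wt x) (k x *: gprod (rser e) x) (th (gprod (pser e) x)).
  have := @lead_gprod _ n x (pser e') id id (fun m => (2 * m + 1)%:R * rser e m)
    (fun m => (2 * m + 1)%:R * rser e m).
  rewrite -/(gprod _ x) gprodM rmorph_gprod => H.
  rewrite (@eq_gprod _ _ _ (pser e')); last first.
    by move=> m /=; rewrite rmorph_pser; apply: eq_pser; apply: grade_evar.
  rewrite -mul_mpolyC /k rmorph_gprod.
  rewrite (@eq_gprod _ _ _ (fun m => (2 * m + 1)%:R : {mpoly F[n]})); last first.
    by move=> m /=; rewrite rmorph_nat.
  by apply: H => m _; apply: pser_graded.
apply: (@indep_lead F _ _ _ _ s c _ (fun x => k x *: gprod (rser e) x) wt id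
  (fun d p => (th p)`_d)).
- move=> d q u v; rewrite rmorphD coefD -mul_mpolyC rmorphM gradeC coefCM.
  by rewrite mul_mpolyC.
- by move=> x y _ _ le; rewrite (lead_coef_ge (leth x) le).
move=> y ys E0.
suff : c y * k y = 0 by move/eqP; rewrite mulf_eq0 (negbTE (kn0 y)) orbF => /eqP.
apply: (@rser_prod_indep F n [seq x <- s | wt x == wt y] (fun x => c x * k x)) => //.
- exact: filter_uniq.
- by apply/allP => x; rewrite mem_filter => /andP[_ /(allP vs)].
- by rewrite big_filter -[RHS]E0; apply: eq_bigr => x _; rewrite scalerA.
by rewrite mem_filter eqxx.
Qed.

(** * Supersymmetric polynomials *)

Lemma eq_mmap (R S : nzRingType) n (f : R -> S) (v w : 'I_n -> S) p :
  v =1 w -> mmap f v p = mmap f w p.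
Proof. by move=> E; apply: eq_bigr => m _; rewrite (mmap1_eq _ E). Qed.

Lemma evar_comp (F : fieldType) n t :
  evar F n t \mPo [tuple mesym n F k.+1 | k < n] = mesym n F t.
Proof.
rewrite /comp_mpoly (@eq_mmap _ _ _ _ _ (fun k : 'I_n => mesym n F k.+1)) => [|o]; last first.
  by rewrite tnth_mktuple.
by apply: (mmap_evar (@mpolyC n F)); [apply: mesym0E | apply: mesym_geqnE].
Qed.

Section Supersymmetric.
Variables (F : fieldType) (n : nat).
Implicit Types f p q : {mpoly F[n]}.
Local Notation T := (@mono_supersym F n).

Lemma sym_mmap (S : comNzRingType) (phi : {rmorphism F -> S}) f (v : 'I_n -> S) (s : 'S_n) :
  f \is symmetric -> mmap phi v f = mmap phi (v \o s) f.
Proof.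
move=> /issymP/(_ s) {1}<-.
apply: (@mpoly_hom_ext _ _ _ (mmap phi v \o msym s) (mmap phi (v \o s))) => [c|l] /=.
  by rewrite /msym !mmapC.
by rewrite /msym !mmapX !mmap1U /= mmapX mmap1U.
Qed.

Lemma perm_two (o0 o1 a b : 'I_n) : o0 != o1 -> a != b ->
  exists s : 'S_n, s o0 = a /\ s o1 = b.
Proof.
move=> no nab; exists (tperm o1 (tperm o0 a b) * tperm o0 a)%g.
rewrite !permM tpermL tpermK; split=> //.
have n1 : tperm o0 a b != o0.
  by apply: contra nab => /eqP E; rewrite -[b](tpermK o0 a) E tpermL.
by rewrite (tpermD (x := o1)) ?tpermL // eq_sym.
Qed.

(** Condition (2) at an arbitrary point and for an arbitrary pair of coordinates, which symmetry
    moves to the first two. *)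
Lemma supersym_eval (S : comNzRingType) (phi : {rmorphism F -> S}) f (v : 'I_n -> S) a b :
    T f -> a != b -> v a = - v b ->
  mmap phi v f = mmap phi (fun k => if (k == a) || (k == b) then 0 else v k) f.
Proof.
move=> [symf Hf] nab vab.
have n2 : (1 < n)%N.
  rewrite ltnNge; apply: contra nab => le.
  by apply/eqP/val_inj; case: a b => a la [b lb] /= in vab *; lia.
pose o0 := Ordinal (ltnW n2); pose o1 := Ordinal n2.
have [s [s0 s1]] := @perm_two o0 o1 a b isT nab.
rewrite (sym_mmap _ v s symf) [RHS](sym_mmap _ _ s symf) /=.
pose w := v \o s; have {vab} w01 : w o0 = - w o1 by rewrite /w /= s0 s1.
have -> : mmap phi (v \o s) f = mmap phi w f by [].
rewrite [RHS](@eq_mmap _ _ _ _ _ (fun k => if (k == o0) || (k == o1) then 0 else w k)); last first.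
  by move=> k /=; rewrite -s0 -s1 !(inj_eq perm_inj).
pose h (l : 'I_n) : {poly {mpoly F[n]}} := if (l : nat) == 0%N then 'X
                        else if (l : nat) == 1%N then - 'X else ('X_l)%:P.
pose sub : {rmorphism {mpoly F[n]} -> {poly {mpoly F[n]}}} :=
  mmap (@polyC {mpoly F[n]} \o @mpolyC n F) h.
have subE t : t = - - t -> mmap phi (fun k => if k == o0 then t else if k == o1 then - t else w k) f
    = horner_eval t (map_poly (mmap phi w) (sub f)).
  move=> _; pose ps := horner_eval t \o (map_poly (mmap phi w) \o sub).
  apply: (@mpoly_hom_ext _ _ _ (mmap phi _) ps) => [c|l].
    by rewrite /ps /= !mmapC /= map_polyC /= mmapC /horner_eval hornerC.
  rewrite /ps /= !mmapX !mmap1U /h -!val_eqE /=.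
  case: eqP => [_|_]; first by rewrite map_polyX /horner_eval hornerX.
  case: eqP => [_|_]; first by rewrite rmorphN /= map_polyX /horner_eval hornerN hornerX.
  by rewrite map_polyC /= mmapX mmap1U /horner_eval hornerC.
have [c fc] : exists c, sub f = c%:P by exists (sub f)`_0; apply: size1_polyC; exact: Hf.
(* The value does not depend on [t]; it is compared at [t = w o0] and at [t = 0]. *)
have cst t : mmap phi (fun k => if k == o0 then t else if k == o1 then - t else w k) f
    = mmap phi w c.
  by rewrite subE ?opprK // fc map_polyC /horner_eval hornerC.
transitivity (mmap phi w c).
  rewrite -(cst (w o0)); apply: eq_mmap => k.
  case: eqP => [->//|_]; case: eqP => [->|//]; by rewrite w01 opprK.
rewrite -(cst 0); apply: eq_mmap => k.
by case: eqP => // _; case: eqP => // _; rewrite oppr0.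
Qed.

Lemma supersym_size p : T p -> (1 < n)%N -> exists c, subst_tmt p = c%:P.
Proof. by move=> [_ H] /H /size1_polyC ->; eexists. Qed.

Let sub : {rmorphism {mpoly F[n]} -> {poly {mpoly F[n]}}} :=
  mmap (@polyC {mpoly F[n]} \o @mpolyC n F) (fun l : 'I_n => if (l : nat) == 0%N then 'X
                        else if (l : nat) == 1%N then - 'X else ('X_l)%:P).
Let subE p : subst_tmt p = sub p. Proof. by []. Qed.

Lemma supersymC c : T c%:MP.
Proof.
split; first by apply/issymP => s; rewrite /msym mmapC.
by move=> _; rewrite subE /= mmapC size_polyC leq_b1.
Qed.

Lemma supersymD p q : T p -> T q -> T (p + q).
Proof.
move=> Tp Tq; split; first by rewrite rpredD //; [case: Tp | case: Tq].
move=> n2; have [c Ec] := supersym_size Tp n2; have [d Ed] := supersym_size Tq n2.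
by rewrite subE rmorphD -!subE Ec Ed -polyCD size_polyC leq_b1.
Qed.

Lemma supersymM p q : T p -> T q -> T (p * q).
Proof.
move=> Tp Tq; split; first by rewrite rpredM //; [case: Tp | case: Tq].
move=> n2; have [c Ec] := supersym_size Tp n2; have [d Ed] := supersym_size Tq n2.
by rewrite subE rmorphM -!subE Ec Ed -polyCM size_polyC leq_b1.
Qed.

Lemma supersymZ c p : T p -> T (c *: p).
Proof. by rewrite -mul_mpolyC; apply: supersymM; apply: supersymC. Qed.

Lemma supersymB p q : T p -> T q -> T (p - q).
Proof. by move=> Tp Tq; rewrite -scaleN1r; apply/supersymD/supersymZ. Qed.

Lemma supersym_sum (I : Type) (r : seq I) (P : pred I) (g : I -> {mpoly F[n]}) :
  (forall x, P x -> T (g x)) -> T (\sum_(x <- r | P x) g x).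
Proof.
move=> H; apply: big_ind; [|exact: supersymD|exact: H].
by have := supersymC 0; rewrite mpolyC0.
Qed.

Lemma supersym_prod (I : Type) (r : seq I) (P : pred I) (g : I -> {mpoly F[n]}) :
  (forall x, P x -> T (g x)) -> T (\prod_(x <- r | P x) g x).
Proof.
move=> H; apply: big_ind; [|exact: supersymM|exact: H].
by have := supersymC 1; rewrite mpolyC1.
Qed.

Lemma supersymX p k : T p -> T (p ^+ k).
Proof. by move=> Tp; rewrite -(card_ord k) -prodr_const; apply: supersym_prod. Qed.

Lemma supersym_psum m : T (psum F n (2 * m + 1)).
Proof.
split.
  apply/issymP => s; rewrite /psum raddf_sum [RHS](reindex_inj (@perm_inj _ s)).
  by apply: eq_bigr => l _; rewrite /= (rmorphXn (msym s)) /= /msym mmapX mmap1U.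
move=> n2; rewrite subE /psum rmorph_sum.
rewrite (bigD1 (Ordinal (ltnW n2))) // (bigD1 (Ordinal n2)) //=.
rewrite addrA !rmorphXn /= !mmapX !mmap1U /= exprNn.
rewrite -[(-1) ^+ _]signr_odd oddD oddM /= expr1 mulN1r subrr add0r.
apply: (big_ind (fun q : {poly {mpoly F[n]}} => size q <= 1)%N).
- by rewrite size_poly0.
- by move=> q q' ? ?; rewrite (leq_trans (size_polyD _ _)) // geq_max; apply/andP.
move=> l /andP[n0 n1]; rewrite rmorphXn /= mmapX mmap1U.
rewrite -!val_eqE /= in n0 n1.
by rewrite (negbTE n0) (negbTE n1) -rmorphXn size_polyC leq_b1.
Qed.

Lemma psum_mesym m : psum F n (2 * m + 1) = pser (mesym n F) m.
Proof. exact: (psum_pser (fun l : 'I_n => 'X_l : {mpoly F[n]}) m). Qed.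

(** Solve [pserE] for [r_m], dividing by [2m + 1]; the other terms involve power sums and earlier
    [r]'s. *)
Lemma supersym_rser m : [pchar F] =i pred0 -> T (rser (mesym n F) m).
Proof.
move=> F0; elim/ltn_ind: m => m IH.
have nz : ((2 * m + 1)%:R : F) != 0 by move/pcharf0P: F0 => ->; rewrite addn1.
have := pserE (mesym n F) m; rewrite -psum_mesym => /(canLR (addrK _)) E.
have -> : rser (mesym n F) m = (2 * m + 1)%:R^-1 *: ((2 * m + 1)%:R * rser (mesym n F) m).
  by rewrite -(mpolyC_nat n) mul_mpolyC scalerA mulVf // scale1r.
rewrite -E; apply: supersymZ; apply: supersymB; first exact: supersym_psum.
apply: supersym_sum => -[t lt] _ /=; apply: supersymM; last first.
  by rewrite -psum_mesym; apply: supersym_psum.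
by apply: supersym_sum => -[u lu] _; apply: supersymM; apply: IH => /=; lia.
Qed.

End Supersymmetric.

(** * The Hankel determinant *)

Lemma mpoly_ring_ind (R : comNzRingType) n (P : {mpoly R[n]} -> Prop) :
  (forall c, P c%:MP) -> (forall l, P 'X_l) ->
  (forall p q, P p -> P q -> P (p + q)) -> (forall p q, P p -> P q -> P (p * q)) ->
  forall p, P p.
Proof.
move=> PC PX PD PM; elim/mpolyind => [|c m p _ _ Pp]; first by have := PC 0; rewrite mpolyC0.
have P1 : P 1 by have := PC 1; rewrite mpolyC1.
apply: PD => //; rewrite -mul_mpolyC; apply: (PM); first exact: PC.
rewrite mpolyXE_id; apply: big_ind => // l _.
elim: (m l) => [//|k IH]; rewrite exprS; exact: PM.
Qed.

Lemma dhomog_bigprod (R : comNzRingType) n (I : Type) (r : seq I) (d : I -> nat)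
    (g : I -> {mpoly R[n]}) :
  (forall x, g x \is (d x).-homog) ->
  \prod_(x <- r) g x \is (\sum_(x <- r) d x)%N.-homog.
Proof.
move=> H; elim: r => [|x r IH]; first by rewrite !big_nil dhomog1.
by rewrite !big_cons dhomogM.
Qed.

Lemma msize_homog (F : fieldType) n (p : {mpoly F[n]}) d :
  p != 0 -> p \is d.-homog -> msize p = d.+1.
Proof.
by move=> nz hp; rewrite -mlead_deg // (dhomog_mf hp) // mlead_supp.
Qed.

Lemma sum_ord_double m : (2 * \sum_(k < m) k = m * m.-1)%N.
Proof.
by elim: m => [|m IH]; rewrite ?big_ord0 // big_ord_recr /= mulnDr IH; case: m {IH} => //= m; nia.
Qed.

Section Divisor.
Variables (F : fieldType) (n : nat).
Hypothesis F0 : [pchar F] =i pred0.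
Local Notation MX := {mpoly F[n]}.
Implicit Types f g : MX.
Local Notation i := (ii n).
Local Notation r := (rser (mesym n F)).

Definition antiv (a b : 'I_n) (k : 'I_n) : MX := if k == a then - 'X_b else 'X_k.
Definition antiev (a b : 'I_n) : MX -> MX := mmap (@mpolyC n F) (antiv a b).
HB.instance Definition _ a b := GRing.RMorphism.on (antiev a b).

Lemma antievX a b k : antiev a b 'X_k = antiv a b k.
Proof. by rewrite /antiev mmapX mmap1U. Qed.

Lemma antiev_sub a b f : exists g, f - antiev a b f = ('X_a + 'X_b) * g.
Proof.
elim/mpoly_ring_ind: f => [c|l|p q [g1 E1] [g2 E2]|p q [g1 E1] [g2 E2]].
- by exists 0; rewrite /antiev mmapC subrr mulr0.
- rewrite antievX /antiv; case: eqP => [->|_]; first by exists 1; rewrite opprK mulr1.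
  by exists 0; rewrite subrr mulr0.
- by exists (g1 + g2); rewrite rmorphD mulrDr -E1 -E2; ring.
exists (g1 * q + antiev a b p * g2).
have -> : ('X_a + 'X_b) * (g1 * q + antiev a b p * g2) =
  (('X_a + 'X_b) * g1) * q + antiev a b p * (('X_a + 'X_b) * g2) by ring.
by rewrite -E1 -E2 rmorphM; ring.
Qed.

(** This plays the role of coprimality of the linear forms [X_a + X_b] for distinct pairs. *)
Lemma antiev_pair (a b c d : 'I_n) : (a < b)%N -> (c < d)%N -> (a, b) != (c, d) ->
  antiev a b ('X_c + 'X_d) != 0.
Proof.
move=> ab cd ne; rewrite rmorphD /= !antievX /antiv.
have ncd : c != d by rewrite -val_eqE /= ltn_eqF.
have C k l : ('X_k : MX)@_U_(l) = (k == l)%:R by rewrite mcoeffXU.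
case: (c =P a) => [Eca|nca].
  rewrite ifN; last by rewrite -Eca eq_sym.
  apply/eqP => /(congr1 (mcoeff U_(d)%MM)) /eqP; rewrite mcoeffD mcoeffN !C eqxx mcoeff0.
  rewrite (_ : b == d = false) ?oppr0 ?add0r ?oner_eq0 //.
  by apply: contraNF ne => /eqP->; rewrite Eca eqxx.
case: (d =P a) => [Eda|nda].
  apply/eqP => /(congr1 (mcoeff U_(c)%MM)) /eqP; rewrite mcoeffD mcoeffN !C eqxx mcoeff0.
  rewrite (_ : b == c = false) ?subr0 ?oner_eq0 //.
  by apply/negP => /eqP E; move: cd; rewrite -E Eda ltnNge ltnW.
apply/eqP => /(congr1 (mcoeff U_(d)%MM)) /eqP; rewrite mcoeffD !C eqxx mcoeff0.
by rewrite (negbTE ncd) add0r oner_eq0.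
Qed.

Definition pairs : seq ('I_n * 'I_n) :=
  [seq p : 'I_n * 'I_n <- enum {: 'I_n * 'I_n} | (p.1 < p.2)%N].
Definition pairprod (L : seq ('I_n * 'I_n)) : MX := \prod_(p <- L) ('X_(p.1) + 'X_(p.2)).

(** The substitution for a new pair kills [f] but none of the factors already extracted, so in a
    domain it kills the cofactor, and [antiev_sub] extracts the new factor. *)
Lemma pairprod_dvd (L : seq ('I_n * 'I_n)) f : uniq L ->
    {in L, forall p : 'I_n * 'I_n, (p.1 < p.2)%N /\ antiev p.1 p.2 f = 0} ->
  exists g, f = pairprod L * g.
Proof.
elim: L => [|[a b] L IH] /= => [_ _|/andP[nL uL] H].
  by exists f; rewrite /pairprod big_nil mul1r.
have [||g Eg] := IH => //; first by move=> p pL; apply: H; rewrite inE pL orbT.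
have [/= ab fab] := H (a, b) (mem_head _ _).
have gab : antiev a b g = 0.
  apply/eqP; move/eqP: fab; rewrite Eg rmorphM mulf_eq0 => /orP[|//].
  rewrite /pairprod rmorph_prod prodf_seq_eq0 => /hasP[[c d] cdL] /= /eqP E.
  have cd : (c < d)%N by have [] := H (c, d); rewrite ?inE ?cdL ?orbT.
  have ne : (a, b) != (c, d) by apply: contraNneq nL => ->.
  by have := antiev_pair ab cd ne; rewrite E eqxx.
have [g' Eg'] := antiev_sub a b g; rewrite gab subr0 in Eg'.
by exists g'; rewrite /pairprod big_cons Eg Eg' /pairprod /=; ring.
Qed.

Lemma size_pairs : (2 * size pairs = n * n.-1)%N.
Proof.
rewrite -sum_ord_double; congr (2 * _)%N.
rewrite size_filter -sum1_count big_enum_cond /=.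
rewrite -(pair_big_dep xpredT (fun a b : 'I_n => (a < b)%N) (fun _ _ => 1%N)) /=.
rewrite (exchange_big_dep xpredT) //=; apply: eq_bigr => b _.
by rewrite -(big_ord_widen n (fun _ => 1%N)) ?(ltnW (ltn_ord b)) // sum1_card card_ord.
Qed.

Lemma pairprod_homog : pairprod pairs \is (size pairs).-homog.
Proof.
have H (p : 'I_n * 'I_n) : ('X_(p.1) + 'X_(p.2) : MX) \is 1.-homog.
  by apply: rpredD; rewrite dhomogX /= mdeg1.
by have := dhomog_bigprod pairs H; rewrite sum1_size.
Qed.

(* [k + l] is shifted by the parity of [n] so that the recurrence of order
   [i] satisfied by [r] applies from the first entry on. *)
Definition hankel (S : comNzRingType) (u : nat -> S) : 'M[S]_i :=
  \matrix_(k, l) u (odd n + k + l)%N.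

Lemma map_hankel (S S' : comNzRingType) (f : {rmorphism S -> S'}) (e : nat -> S) e' :
  (forall k, f (e k) = e' k) -> map_mx f (hankel (rser e)) = hankel (rser e').
Proof. by move=> E; apply/matrixP => k l; rewrite !mxE rmorph_rser; apply: eq_rser. Qed.

Lemma rmorph_hankel (S S' : comNzRingType) (f : {rmorphism S -> S'}) (e : nat -> S) e' :
  (forall k, f (e k) = e' k) -> f (\det (hankel (rser e))) = \det (hankel (rser e')).
Proof. by move=> E; rewrite -det_map_mx (map_hankel E). Qed.

Definition hdet : MX := \det (hankel r).

Lemma hdet_supersym : mono_supersym hdet.
Proof.
apply: supersym_sum => s _; rewrite -(rmorph_sign (@mpolyC n F)).
apply: supersymM; first exact: supersymC.
by apply: supersym_prod => k _; rewrite mxE; apply: supersym_rser.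
Qed.

(** Since [r_m] has degree [2m + 1], every term of the determinant has degree [n(n-1)/2], the number
    of pairs. *)
Lemma hdet_homog : hdet \is (size pairs).-homog.
Proof.
have hr m : r m \is (2 * m + 1).-homog.
  elim/ltn_ind: m => m IH; rewrite /rser sdivE -/r; apply: rpredB; first exact: dhomog_mesym.
  apply: rpred_sum => -[t lt] _ /=.
  rewrite (_ : 2 * m + 1 = 2 * t.+1 + (2 * (m - t.+1) + 1))%N; last by lia.
  by apply: dhomogM; [exact: dhomog_mesym | apply: IH; lia].
apply: rpred_sum => s _; rewrite rpredMsign.
have H (k : 'I_i) : hankel r k (s k) \is (2 * (odd n + k + s k) + 1).-homog.
  by rewrite mxE.
have := dhomog_bigprod (index_enum 'I_i) H; congr (_ \is _.-homog).
have E : (\sum_k s k = \sum_(k < i) k)%N by rewrite [RHS](reindex_inj (@perm_inj _ s)).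
have cst : (\sum_(k < i) (2 * odd n + 1) = i * (2 * odd n + 1))%N.
  by rewrite sum_nat_const card_ord.
have -> : (\sum_(k < i) (2 * (odd n + k + s k) + 1) =
    i * (2 * odd n + 1) + 2 * \sum_(k < i) k + 2 * \sum_k s k)%N.
  rewrite -cst !big_distrr -!big_split /=; apply: eq_bigr => k _.
  by move: (nat_of_bool _) (nat_of_ord k) (nat_of_ord (s k)) => x y z; lia.
rewrite E; have := size_pairs; have := sum_ord_double i; rewrite /ii.
move: (size pairs) (\sum_(k < n./2) k)%N => N S.
have := odd_double_half n; case: (odd n) => /= <-; rewrite ?doubleK -muln2; nia.
Qed.

Lemma hdet_comp :
  hdet = \det (hankel (rser (evar F n))) \mPo [tuple mesym n F k.+1 | k < n].
Proof.
set S := [tuple _ | k < n].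
by symmetry; apply: (rmorph_hankel (f := comp_mpoly S)) => t; apply: evar_comp.
Qed.

(** The [e_k] being algebraically independent, one specialisation suffices. With
    [e_0 = e_(2j+1) = 1] and the others 0, [R = y^j] and the Hankel matrix is the antidiagonal
    permutation matrix. *)
Lemma hdet_neq0 : (0 < n)%N -> hdet != 0.
Proof.
move=> n0; apply/eqP; rewrite hdet_comp => /msym_fundamental_un0.
pose c k : F := ((k == 0%N) || (k == 2 * jj n + 1)%N)%:R.
pose psi : {rmorphism MX -> F} := mmap (idfun : {rmorphism F -> F}) (fun o : 'I_n => c o.+1).
move/(congr1 psi); rewrite rmorph0 -det_map_mx.
have rc m : rser c m = (m == jj n)%:R.
  rewrite /rser sdivE big1 ?subr0.
    by rewrite /c addn1 /= addn1 eqSS eqn_pmul2l.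
  by move=> t _; rewrite /c (_ : _ || _ = false) ?mul0r //; lia.
have -> : map_mx psi (hankel (rser (evar F n))) = perm_mx (perm (@rev_ord_inj i)).
  rewrite (@map_hankel _ _ psi _ c) => [|t /=]; last first.
    apply: mmap_evar => // {}t lt; rewrite /c (_ : _ || _ = false) //.
    by move: n0 lt; rewrite /jj; lia.
  apply/matrixP => k l; rewrite !mxE rc permE.
  rewrite -val_eqE /=; congr (nat_of_bool _)%:R.
  by case: k l => k lk [l ll] /=; move: n0 lk ll; rewrite /jj /ii; lia.
by rewrite det_perm => /eqP; rewrite signr_eq0.
Qed.

(** By supersymmetry both variables may be set to 0. With [n - 2] variables left, [e_k = 0] for
    [k >= n - 1], so the [r]'s satisfy a recurrence of order [i - 1], which is a linear relation
    between the rows. *)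
Lemma hdet_antiev a b : a != b -> antiev a b hdet = 0.
Proof.
move=> nab; rewrite /antiev (supersym_eval _ hdet_supersym nab); last first.
  by rewrite /antiv eqxx eq_sym (negbTE nab).
set v := fun k : 'I_n => _.
pose ev : {rmorphism MX -> MX} := mmap (@mpolyC n F) v.
have e0 k : (n.-1 <= k)%N -> esy v k = 0.
  move=> lk; rewrite /esy big1 // => h /eqP hk.
  case: (boolP ((a \in h) || (b \in h))) => [/orP[] m|].
  - by rewrite (bigD1 a) //= /v eqxx mul0r.
  - by rewrite (bigD1 b) //= /v eqxx orbT mul0r.
  rewrite negb_or => /andP[na nb].
  have : (#|h| <= #|~: [set a; b]|)%N.
    apply/subset_leq_card/subsetP => x xh; rewrite !inE negb_or.
    by apply/andP; split; [apply: contraNneq na | apply: contraNneq nb] => <-.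
  have := cardsC [set a; b]; rewrite cards2 nab card_ord hk; lia.
have i0 : (0 < i)%N.
  by case: a b nab {v ev e0} => a la [b lb]; rewrite -val_eqE /ii /=; lia.
pose e := esy v.
have -> : mmap (@mpolyC n F) v hdet = \det (hankel (rser e)).
  apply: (rmorph_hankel (f := ev)) => t; apply: etrans (rmorph_esy ev _ _) _.
  by apply: eq_esy => k' /=; rewrite mmapX mmap1U.
apply/eqP/det0P.
(* The recurrence coefficients in reverse order; the last one is [e_0 = 1], so the row is
   nonzero. *)
exists (\row_k e (2 * (i.-1 - k))%N).
  have li : (i.-1 < i)%N by rewrite prednK.
  apply/eqP => /rowP/(_ (Ordinal li)); rewrite !mxE /= subnn muln0 /e esy0.
  by move/eqP; rewrite oner_eq0.
apply/rowP => l; rewrite !mxE.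
have := sconv_rser (odd n + i.-1 + l) (esy0 v); rewrite -/e.
rewrite [RHS]e0; last by move: i0; rewrite /ii; lia.
rewrite /sconv (_ : (odd n + i.-1 + l).+1 = i + (odd n + l))%N; last by move: i0; lia.
rewrite big_split_ord /= [X in _ + X]big1 ?addr0 => [E|t _]; last first.
  by rewrite /e e0 ?mul0r //; rewrite /ii; lia.
rewrite -[RHS]E (reindex_inj rev_ord_inj); apply: eq_bigr => -[k lk] _ /=.
rewrite !mxE /=; congr (e _ * rser e _); move: i0 lk; lia.
Qed.

(** Both [f] and [hdet] are divisible by the product of the [X_a + X_b]; equality of degrees makes
    the cofactor of [hdet] a nonzero scalar. *)
Lemma hdet_dvd f : (0 < n)%N -> (forall a b, a != b -> antiev a b f = 0) ->
  exists g, f = hdet * g.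
Proof.
move=> n0 H; have dv h : (forall a b, a != b -> antiev a b h = 0) ->
    exists g, h = pairprod pairs * g.
  move=> hh; apply: pairprod_dvd; first exact/filter_uniq/enum_uniq.
  move=> p; rewrite mem_filter => /andP[lp _]; split=> //.
  by apply: hh; rewrite -val_eqE /= ltn_eqF.
have [g Eg] := dv f H; have [c Ec] := dv hdet hdet_antiev.
have D0 := hdet_neq0 n0; have := D0; rewrite {1}Ec mulf_eq0 negb_or => /andP[P0 c0].
have : msize c = 1%N.
  have := msize_homog D0 hdet_homog; rewrite {1}Ec msizeM //.
  by rewrite (msize_homog P0 pairprod_homog) addSn /= -addn1 => /addnI.
move/eqP/msize_poly1P => [d d0 Ed]; exists (d^-1 *: g).
by rewrite Ec Ed -scalerAr mulrAC -Eg [f * _]mulrC mul_mpolyC scalerA mulVf // scale1r.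
Qed.

End Divisor.

(** * The kernel of the restriction *)

(** One unsorted list carries all the data of a proper product: repetitions of indices up to [j]
    stand for the exponents. *)
Definition proper_list n (s : seq nat) := (count (fun m => jj n < m)%N s <= ii n)%N.

Definition spanned (F : fieldType) (V : comAlgType F) n (q : nat -> V) : V -> Prop :=
  lspan (fun v => exists s, proper_list n s /\ v = \prod_(m <- s) q m).

Section Kernel.
Variables (F : fieldType) (n : nat).
Hypotheses (F0 : [pchar F] =i pred0) (n0 : (0 < n)%N).
Local Notation MX := {mpoly F[n]}.
Local Notation i := (ii n).
Local Notation j := (jj n).
Local Notation e := (mesym n F).
Local Notation r := (rser e).
Local Notation S := [tuple mesym n F k.+1 | k < n].

Let evA : {rmorphism {mpoly F[i]} -> MX} :=
  mmap (@mpolyC n F) (fun o : 'I_i => e (2 * o.+1)%N).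

Let evA_evar t : evA (evar F i t) = e (2 * t)%N.
Proof.
apply: (@mmap_evar F MX i (@mpolyC n F) (fun t => e (2 * t)%N) t).
  by rewrite mesym0E.
by move=> k lk; rewrite mesym_geqnE //; move: lk; rewrite /ii; lia.
Qed.

(** The shift by the parity of [n] makes the index [2 (odd n + m + i + l) + 1] exceed [n] already at
    [m = l = 0], so the corresponding coefficient of [B] vanishes. *)
Lemma recur_shift l : recur i (fun t => e (2 * t)%N) (fun m => r (odd n + m + l)%N).
Proof.
move=> m; have := sconv_rser (odd n + m + i + l) (mesym0E n F).
rewrite mesym_geqnE; last by rewrite /ii; lia.
rewrite /sconv (_ : (odd n + m + i + l).+1 = i.+1 + (odd n + m + l))%N; last by lia.
rewrite big_split_ord /= [X in _ + X]big1 ?addr0 => [E|t _]; last first.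
  by rewrite mesym_geqnE ?mul0r //; rewrite /ii; lia.
rewrite -[RHS]E; apply: eq_bigr => -[t lt] _ /=; congr (_ * r _); lia.
Qed.

(** By [det_recur], the product is the minor of the infinite Hankel matrix on the rows
    [odd n + nu k]; each term of it has exactly [i] factors. *)
Lemma hdet_minor (nu : 'I_i -> nat) :
  hdet F n * evA (\det (hmx (evar F i) nu)) =
    \sum_(s : 'S_i) (-1) ^+ s * \prod_k r (odd n + nu k + s k)%N.
Proof.
have -> : evA (\det (hmx (evar F i) nu)) = \det (hmx (fun t => e (2 * t)%N) nu).
  by apply: (rmorph_det_hmx (f := evA)); apply: evA_evar.
have a0 : e (2 * 0)%N = 1 by rewrite mesym0E.
have ai t : (i < t)%N -> e (2 * t)%N = 0.
  by move=> lk; rewrite mesym_geqnE //; move: lk; rewrite /ii; lia.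
have := @det_recur _ i (fun t => e (2 * t)%N) a0 ai
  (fun l m => r (odd n + m + l)%N) nu (fun l => recur_shift l).
move=> E; rewrite [hdet F n * _]mulrC; apply: etrans (esym E) _.
by apply: eq_bigr => s _; congr (_ * _); apply: eq_bigr => k _; rewrite mxE.
Qed.

Lemma hdet_span (u : {mpoly F[i]}) s : all (fun m => m <= j)%N s ->
  spanned n r (hdet F n * evA u * \prod_(m <- s) r m).
Proof.
move=> sj; have := det_hmx_span u F0.
apply: (@lspan_map _ _ _ (fun u => hdet F n * evA u * \prod_(m <- s) r m)).
  move=> c v w; rewrite rmorphD mulrDr mulrDl -mul_mpolyC rmorphM.
  by rewrite {2}/evA /= mmapC mul_mpolyC -scalerAr -scalerAl.
move=> _ [nu ->]; rewrite hdet_minor mulr_suml; apply: lspan_sum => t _.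
rewrite -mulrA -(rmorph_sign (@mpolyC n F)) mul_mpolyC.
apply/lspan_scale/lspan_mem.
exists ([seq (odd n + nu k + t k)%N | k <- enum 'I_i] ++ s); split.
  rewrite /proper_list count_cat (@eq_in_count _ _ pred0 s) => [|m /(allP sj)]; last first.
    by rewrite ltnNge => ->.
  by rewrite count_pred0 addn0 (leq_trans (count_size _ _)) // size_map size_enum_ord.
by rewrite big_cat big_map big_enum.
Qed.

Lemma hdet_sym_span (G : MX) : spanned n r (hdet F n * (G \mPo S)).
Proof.
(* The statement is strengthened by a polynomial in the even [e_k] and by a product of [r]'s of
   index at most [j], which may occur without limit. *)
pose Q (H : MX) := forall u s, all (fun m => m <= j)%N s ->
  spanned n r (hdet F n * evA u * \prod_(m <- s) r m * (H \mPo S)).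
(* Even [e_k] are absorbed by [u]; odd ones are expanded as [e = A R]. *)
have QH (H : MX) : forall H', Q H' -> Q (H' * H).
  elim/mpoly_ring_ind: H => [c H' QH' u s sj|l H' QH' u s sj|p q Qp Qq H' QH' u s sj|p q Qp Qq H' QH'].
  - rewrite rmorphM /= comp_mpolyC mulrA mulrC mul_mpolyC.
    by apply: lspan_scale; apply: QH'.
  - have absorb t s' : all (fun m => m <= j)%N s' ->
        spanned n r (hdet F n * evA u * \prod_(m <- s') r m * (H' \mPo S) * e (2 * t)%N).
      move=> s'j; rewrite -evA_evar; have := QH' (u * evar F i t) s' s'j.
      by rewrite rmorphM; congr (spanned _ _ _); ring.
    rewrite rmorphM /= comp_mpolyXU -tnth_nth tnth_mktuple mulrA.
    case: (boolP (odd l.+1)) => ol; last first.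
      rewrite (_ : nat_of_ord l = (2 * l.+1./2).-1); last by lia.
      by rewrite prednK; [apply: absorb | lia].
    set m := l.+1./2; have ml : l.+1 = (2 * m + 1)%N by rewrite /m; lia.
    have mj : (m <= j)%N by rewrite -jj_odd // -ml.
    rewrite ml -sconv_rser ?mesym0E // mulr_sumr; apply: lspan_sum => -[t lt] _ /=.
    have := absorb t ((m - t)%N :: s); rewrite /= sj andbT big_cons.
    move=> /(_ (leq_trans (leq_subr _ _) mj)) H.
    by move: H; congr (spanned _ _ _); ring.
  - by rewrite mulrDr rmorphD mulrDr; apply: lspan_add; [apply: Qp | apply: Qq].
  by rewrite mulrA; apply: Qq; apply: Qp.
have Q1 : Q 1.
  by move=> u s sj; rewrite rmorph1 mulr1; apply: hdet_span.
have := QH G 1 Q1 1 [::] isT.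
by rewrite rmorph1 big_nil mul1r !mulr1.
Qed.

Lemma kernel_span (f : MX) : f \is symmetric ->
    (forall a b, a != b -> antiev a b f = 0) -> spanned n r f.
Proof.
move=> symf /(hdet_dvd F0 n0)[g Eg]; rewrite Eg in symf *.
have symg : g \is symmetric.
  by apply: msymMK symf; [apply: hdet_neq0 | case: (hdet_supersym n F0)].
by have [G [<- _]] := sym_fundamental symg; apply: hdet_sym_span.
Qed.

End Kernel.

(** * Restriction to two variables less *)

Lemma lspan_mul (F : fieldType) (V : comAlgType F) (Q1 Q2 Q3 : V -> Prop) u v :
  (forall u v, Q1 u -> Q2 v -> Q3 (u * v)) ->
  lspan Q1 u -> lspan Q2 v -> lspan Q3 (u * v).
Proof.
move=> H su sv; apply: (lspan_map (f := fun u => u * v)) su => [c a b|a Qa].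
  by rewrite mulrDl -scalerAl.
apply: (lspan_map (f := fun v => a * v)) sv => [c x y|x Qx].
  by rewrite mulrDr -scalerAr.
by apply/lspan_mem/H.
Qed.

Lemma lspan_lift (F : fieldType) (V W : lmodType F) (f : V -> W) (P : V -> Prop)
    (Q : W -> Prop) (Q' : V -> Prop) w :
  (forall c u v, f (c *: u + v) = c *: f u + f v) ->
  (forall c u v, P u -> P v -> P (c *: u + v)) -> P 0 ->
  (forall w, Q w -> exists v, [/\ Q' v, P v & f v = w]) ->
  lspan Q w -> exists v, [/\ lspan Q' v, P v & f v = w].
Proof.
move=> lf lP P0 H; elim=> [|c u w' /H[v [Qv Pv <-]] _ [v' [sv' Pv' <-]]].
  exists 0; split=> //; first exact: lspan0.
  by have := lf (-1) 0 0; rewrite scaler0 addr0 scaleN1r addNr.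
by exists (c *: v + v'); split; [apply: lspanS | apply: lP | apply: lf].
Qed.

Lemma lspan_finite (F : fieldType) (V : lmodType F) (I : eqType) (P : pred I)
    (f : I -> V) v : lspan (fun v => exists x, P x /\ v = f x) v ->
  exists (s : seq I) (a : I -> F), all P s /\ v = \sum_(x <- s) a x *: f x.
Proof.
(* Coefficients are a function of the index, so an index met again must have its coefficient
   updated; this requires a list without repetition. *)
suff: lspan (fun v => exists x, P x /\ v = f x) v ->
    exists (s : seq I) (a : I -> F), [/\ uniq s, all P s & v = \sum_(x <- s) a x *: f x].
  by move=> H /H[s [a [_ ? ?]]]; exists s, a.
elim=> [|c u w [x [Px ->]] _ [s [a [us sP ->]]]].
  by exists [::], (fun=> 0); rewrite big_nil.
have [xs|nxs] := boolP (x \in s); last first.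
  exists (x :: s), (fun y => if y == x then c else a y); rewrite /= nxs us Px sP.
  split=> //; rewrite big_cons eqxx; congr (_ + _); apply: eq_big_seq => y ys.
  by rewrite ifN //; apply: contraNneq nxs => <-.
exists s, (fun y => if y == x then c + a y else a y); split=> //.
rewrite !(bigD1_seq x) //= eqxx scalerDl addrA; congr (_ + _).
by apply: eq_bigr => y /negbTE->.
Qed.

Lemma esy_last (S : comNzRingType) n (v : 'I_n.+1 -> S) k : v ord_max = 0 ->
  esy v k = esy (v \o widen_ord (leqnSn n)) k.
Proof.
by move=> v0; rewrite -!coef_egen /egen big_ord_recr /= v0 polyC0 mulr0 addr0 mulr1.
Qed.

Section Spanning.
Variable F : fieldType.
Hypothesis F0 : [pchar F] =i pred0.

Lemma proper_list_SS n s : proper_list n s -> proper_list n.+2 s.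
Proof.
rewrite /proper_list /ii /= => le.
apply: leq_trans (leq_trans _ le) (leqnSn _).
by apply: sub_count => m /=; rewrite /jj; lia.
Qed.

Lemma supersym_rprod n (s : seq nat) :
  mono_supersym (\prod_(m <- s) rser (mesym n F) m).
Proof. by apply: supersym_prod => m _; apply: supersym_rser. Qed.

Section Restriction.
Variable n : nat.
(** Equals [X_k] for [k < n] and 0 at the last two indices. *)
Let zv (k : 'I_n.+2) : {mpoly F[n]} := evar F n k.+1.
Definition restr : {rmorphism {mpoly F[n.+2]} -> {mpoly F[n]}} := mmap (@mpolyC n F) zv.

Lemma restrC c : restr c%:MP = c%:MP.
Proof. exact: mmapC. Qed.

Lemma restrX k : restr 'X_k = zv k.
Proof. by rewrite /restr /= mmapX mmap1U. Qed.

Lemma restr_mesym k : restr (mesym n.+2 F k) = mesym n F k.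
Proof.
apply: etrans (rmorph_esy restr _ _) _.
rewrite (eq_esy (w := zv)) => [|l]; last exact: restrX.
rewrite !esy_last; [|exact: evar_gt..].
by apply: eq_esy => l; rewrite /= /zv -(evarS F).
Qed.

Lemma restr_rser m : restr (rser (mesym n.+2 F) m) = rser (mesym n F) m.
Proof. by rewrite (rmorph_rser restr); apply: eq_rser; apply: restr_mesym. Qed.

(** Symmetry holds because [restr] sends each [e_k] to [e_k]. For condition (2), [supersym_eval]
    replaces the values [t], [-t] of the first two variables by 0. *)
Lemma restr_supersym f : mono_supersym f -> mono_supersym (restr f).
Proof.
move=> Tf; have [symf _] := Tf; split.
  have [G [<- _]] := sym_fundamental symf.
  have -> : restr (G \mPo [tuple mesym n.+2 F k.+1 | k < n.+2]) =
      G \mPo [tuple mesym n F k.+1 | k < n.+2].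
    apply: (@mpoly_hom_ext _ _ _ (restr \o comp_mpoly _) (comp_mpoly _)) => [c|l] /=.
      by rewrite !comp_mpolyC mmapC.
    by rewrite !comp_mpolyXU -!tnth_nth !tnth_mktuple restr_mesym.
  by apply: mcomp_sym => k; rewrite -tnth_nth tnth_mktuple mesym_sym.
move=> n1.
pose h (l : 'I_n) : {poly {mpoly F[n]}} := if (l : nat) == 0%N then 'X
                        else if (l : nat) == 1%N then - 'X else ('X_l)%:P.
pose g := @polyC {mpoly F[n]} \o @mpolyC n F.
pose sub : {rmorphism {mpoly F[n]} -> {poly {mpoly F[n]}}} := mmap g h.
have -> : subst_tmt (restr f) = mmap g (fun k => sub (zv k)) f.
  apply: (@mpoly_hom_ext _ _ _ (sub \o restr) (mmap g (fun k => sub (zv k)))) => [c|l] /=.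
    by rewrite !mmapC.
  by rewrite !mmapX !mmap1U.
have z (l : 'I_n) (k : 'I_n.+2) : l = k :> nat -> sub (zv k) = h l.
  by move=> E; rewrite /zv -E evarS /= mmapX mmap1U.
pose o0 : 'I_n.+2 := Ordinal (isT : (0 < n.+2)%N).
pose o1 : 'I_n.+2 := Ordinal (isT : (1 < n.+2)%N).
rewrite (@supersym_eval _ _ _ g _ _ o0 o1 Tf) //; last first.
  by rewrite (z (Ordinal (ltnW n1))) // (z (Ordinal n1)) // /h /= opprK.
pose y k := if (k == o0) || (k == o1) then 0 else zv k.
have -> : mmap g (fun k => if (k == o0) || (k == o1) then 0 else sub (zv k)) f =
    (mmap (@mpolyC n F) y f)%:P.
  apply: (@mpoly_hom_ext _ _ _ (mmap g _) (@polyC _ \o mmap (@mpolyC n F) y)) => [c|k] /=.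
    by rewrite !mmapC.
  rewrite !mmapX !mmap1U /y; case: ifP => [_|]; first by rewrite polyC0.
  rewrite -!val_eqE /= => /norP[k0 k1].
  case: (ltnP k n) => lk; last by rewrite /zv evar_gt // rmorph0.
  by rewrite (z (Ordinal lk)) // /h /= (negbTE k0) (negbTE k1) /zv -(evarS F).
by rewrite size_polyC leq_b1.
Qed.

(** Supersymmetry replaces [X_a = - X_b] by [X_a = X_b = 0]; symmetry moves these zeros to the last
    two variables, and the evaluation factors through [restr]. *)
Lemma restr0_antiev f a b : mono_supersym f -> restr f = 0 -> a != b ->
  antiev a b f = 0.
Proof.
move=> Tf f0 nab; rewrite /antiev (supersym_eval _ Tf nab); last first.
  by rewrite /antiv eqxx eq_sym (negbTE nab).
set v := fun k : 'I_n.+2 => _.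
pose on : 'I_n.+2 := Ordinal (ltnW (ltnSn n.+1)).
pose on1 : 'I_n.+2 := Ordinal (ltnSn n.+1).
have [s [sa sb]] : exists s : 'S_n.+2, s on = a /\ s on1 = b.
  by apply: perm_two nab; rewrite -val_eqE /= ltn_eqF.
rewrite (sym_mmap _ v s); last by case: Tf.
pose y (l : 'I_n) := v (s (widen_ord (leq_trans (leqnSn n) (leqnSn _)) l)).
have -> : mmap (@mpolyC n.+2 F) (v \o s) f = mmap (@mpolyC n.+2 F) y (restr f).
  apply: (@mpoly_hom_ext _ _ _ (mmap _ (v \o s)) (mmap (@mpolyC n.+2 F) y \o restr)) => [c|k] /=.
    by rewrite !mmapC.
  rewrite [mmap _ zv _]restrX mmapX mmap1U /=; case: (ltnP k n) => lk.
    have -> : zv k = 'X_(Ordinal lk) by rewrite -evarS.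
    rewrite mmapX mmap1U /y.
    by congr (v (s _)); apply: val_inj.
  rewrite /zv evar_gt // mmap0 /v.
  have : (k == on) || (k == on1).
    by rewrite -!val_eqE /=; have := ltn_ord k; lia.
  by case/orP => /eqP->; rewrite ?sa ?sb eqxx ?orbT.
by rewrite f0 mmap0.
Qed.

End Restriction.

(** Lift an expression of [restr f] by the same products in [n + 2] variables, where they remain
    proper. The difference restricts to 0, so [kernel_span] applies; for [n = 1] there is no pair of
    variables and it applies at once. *)
Lemma supersym_rspan n (f : {mpoly F[n]}) :
  mono_supersym f -> spanned n (rser (mesym n F)) f.
Proof.
elim/ltn_ind: n f => -[|[|n]] IH f Tf.
- have -> : f = f@_0%MM *: 1 by rewrite -mul_mpolyC mulr1; apply: nvar0_mpolyC.
  by apply/lspan_scale/lspan_mem; exists [::]; rewrite big_nil.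
- by apply: kernel_span => //; [case: Tf | move=> a b; rewrite !ord1 eqxx].
have sf := IH n (leqW (ltnSn n)) _ (restr_supersym Tf).
have [g [sg Tg Eg]] : exists g, [/\ spanned n.+2 (rser (mesym n.+2 F)) g, mono_supersym g
    & restr n g = restr n f].
  apply: lspan_lift sf => [c u v|c u v Tu Tv||w [s [ps ->]]].
  - by rewrite rmorphD -mul_mpolyC rmorphM restrC mul_mpolyC.
  - by apply: supersymD Tv; apply: supersymZ.
  - by have := supersymC n.+2 (0 : F); rewrite mpolyC0.
  exists (\prod_(m <- s) rser (mesym n.+2 F) m); split.
  - by exists s; split=> //; apply: proper_list_SS.
  - exact: supersym_rprod.
  by rewrite rmorph_prod; apply: eq_bigr => m _; apply: restr_rser.
rewrite -[f](subrK g); apply: lspan_add sg.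
have Tfg : mono_supersym (f - g) by apply: supersymB.
apply: kernel_span => //; first by case: Tfg.
by move=> a b; apply: (restr0_antiev Tfg); rewrite rmorphB Eg subrr.
Qed.

End Spanning.

(** * Generation by odd power sums *)

Section LowerTerms.
Variables (F : fieldType) (V : comAlgType F) (e : nat -> V).
Let r := rser e.
Let p := pser e.

(** Filtration by total index; [p m] and [(2m + 1) r m] will agree modulo its step [m]. *)
Let low d := lspan (fun v : V => exists s, (sumn s < d)%N /\ v = \prod_(m <- s) r m).

Lemma low_mul a b u v : low a.+1 u -> low b v -> low (a + b) (u * v).
Proof.
apply: lspan_mul => _ _ [s [ls ->]] [t [lt ->]].
exists (s ++ t); rewrite sumn_cat big_cat; split=> //.
by rewrite -ltnS -addSn; lia.
Qed.

Lemma low_leq a b u : (a <= b)%N -> low a u -> low b u.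
Proof.
move=> le; apply: lspan_bind => _ [s [ls ->]]; apply: lspan_mem.
by exists s; split=> //; apply: leq_trans le.
Qed.

Lemma low_rprod s : low (sumn s).+1 (\prod_(m <- s) r m).
Proof. by apply: lspan_mem; exists s. Qed.

Lemma low_r m : low m.+1 (r m).
Proof. by have := low_rprod [:: m]; rewrite big_seq1 /= addn0. Qed.

Lemma low_pB m : low m (p m - (2 * m + 1)%:R *: r m).
Proof.
elim/ltn_ind: m => m IH; have low_p t : (t < m)%N -> low t.+1 (p t).
  move=> /IH H; rewrite -[p t](subrK ((2 * t + 1)%:R *: r t)); apply: lspan_add.
    exact: low_leq H.
  by apply: lspan_scale; apply: low_r.
rewrite /p pserE -/r scaler_nat mulr_natl addrC addKr; apply: lspan_sum => -[t lt] _ /=.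
apply: (@low_leq (t + (m - t.+1).+1)); first by lia.
apply: low_mul; last by apply: low_p; lia.
apply: lspan_sum => -[u lu] _ /=; apply: (@low_leq (u + (t - u).+1)); first by lia.
by apply: low_mul; apply: low_r.
Qed.

Lemma low_pprodB s :
  low (sumn s) (\prod_(m <- s) p m -
    (\prod_(m <- s) (2 * m + 1)%:R : F) *: \prod_(m <- s) r m).
Proof.
elim: s => [|m s IH]; first by rewrite !big_nil scale1r subrr; apply: lspan0.
rewrite !big_cons; set P := \prod_(_ <- s) p _ in IH *; set R := \prod_(_ <- s) r _ in IH *.
set k := \prod_(_ <- s) _ in IH *; set c : F := (_ + _)%:R.
have -> : p m * P - (c * k) *: (r m * R) = (p m - c *: r m) * P + c *: (r m * (P - k *: R)).
  rewrite mulrBl mulrBr scalerBr -scalerAl -scalerAr -scalerA; ring.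
have sP : low (sumn s).+1 P.
  by rewrite -[P](subrK (k *: R)); apply: lspan_add;
    [apply: low_leq IH | apply: lspan_scale; apply: low_rprod].
apply: lspan_add; last by apply: lspan_scale; apply: low_mul IH; apply: low_r.
by rewrite mulrC /= addnC; apply: low_mul sP _; apply: low_pB.
Qed.

End LowerTerms.

Section Generation.
Variables (F : fieldType) (n : nat).
Hypothesis F0 : [pchar F] =i pred0.
Local Notation e := (evar F n).
Local Notation S := [tuple mesym n F k.+1 | k < n].

Lemma comp_rprod s : (\prod_(m <- s) rser e m) \mPo S = \prod_(m <- s) rser (mesym n F) m.
Proof.
rewrite rmorph_prod; apply: eq_bigr => m _; rewrite (rmorph_rser (comp_mpoly S)).
by apply: eq_rser => t; apply: evar_comp.
Qed.

Lemma comp_pprod s : (\prod_(m <- s) pser e m) \mPo S = \prod_(m <- s) psum F n (2 * m + 1).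
Proof.
rewrite rmorph_prod; apply: eq_bigr => m _; rewrite (rmorph_pser (comp_mpoly S)).
by rewrite psum_mesym; apply: eq_pser => t; apply: evar_comp.
Qed.

Lemma grade_rprod s :
  grade F n (\prod_(m <- s) rser e m) = (\prod_(m <- s) rser e m)%:P * 'X^(sumn s).
Proof.
elim: s => [|m s IH]; first by rewrite !big_nil rmorph1 mul1r.
by rewrite !big_cons rmorphM IH grade_rser /= exprD rmorphM; ring.
Qed.

(** [supersym_rspan] is transported to the variables [e_k] by algebraic independence; its
    homogeneous component of weight [sumn s] is then extracted. Keeping the total index makes the
    next induction possible. *)
Lemma rprod_straighten s :
  lspan (fun v => exists t, [/\ proper_list n t, sumn t = sumn s
                              & v = \prod_(m <- t) rser e m])
    (\prod_(m <- s) rser e m).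
Proof.
have := supersym_rspan F0 (supersym_rprod F0 n s).
move=> H; have [w [sw _ Ew]] : exists w, [/\ spanned n (rser e) w, True
    & w \mPo S = \prod_(m <- s) rser (mesym n F) m].
  apply: lspan_lift H => // [c u v|v [t [pt ->]]]; first by rewrite linearP.
  exists (\prod_(m <- t) rser e m); split=> //; last exact: comp_rprod.
  by exists t.
have Es : w = \prod_(m <- s) rser e m.
  by apply: msym_fundamental_un; rewrite Ew comp_rprod.
have -> : \prod_(m <- s) rser e m = (grade F n w)`_(sumn s).
  by rewrite Es grade_rprod coef_CXn eqxx; reflexivity.
apply: (lspan_map (f := fun w => (grade F n w)`_(sumn s))) sw => [c u v|_ [t [pt ->]]].
  by rewrite -mul_mpolyC rmorphD rmorphM gradeC coefD coefCM mul_mpolyC.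
rewrite grade_rprod coef_CXn; case: eqP => E; last exact: lspan0.
by apply: lspan_mem; exists t; split; [exact: pt | exact: esym E | reflexivity].
Qed.

(** Induction on the total index: straighten to proper products, then exchange [r]'s for [p]'s; by
    [low_pprodB] the error has smaller total index. *)
Lemma rprod_pspan s : spanned n (pser e) (\prod_(m <- s) rser e m).
Proof.
have [N] := ubnP (sumn s); elim: N s => // N IH s; rewrite ltnS => lN.
apply: lspan_bind (rprod_straighten s) => _ [t [pt Et ->]].
pose k : F := \prod_(m <- t) (2 * m + 1)%:R.
have k0 : k != 0.
  rewrite prodf_seq_neq0; apply/allP => m _ /=.
  by move/pcharf0P: F0 => ->; rewrite addn1.
have -> : \prod_(m <- t) rser e m = k^-1 *: (\prod_(m <- t) pser e m -
    (\prod_(m <- t) pser e m - k *: \prod_(m <- t) rser e m)).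
  by rewrite opprB addrC subrK scalerA mulVf // scale1r.
apply: lspan_scale; rewrite -scaleN1r; apply: lspan_add.
  by apply: lspan_mem; exists t; split; [exact: pt | reflexivity].
apply: lspan_scale; apply: lspan_bind (low_pprodB e t) => _ [y [ly ->]].
by apply: IH; rewrite (leq_trans ly) // Et.
Qed.

Lemma supersym_pspan f : mono_supersym f ->
  lspan (fun v => exists s, proper_list n s /\ v = \prod_(m <- s) psum F n (2 * m + 1)) f.
Proof.
move=> /(supersym_rspan F0); apply: lspan_bind => _ [s [_ ->]].
rewrite -comp_rprod.
apply: (lspan_map (f := comp_mpoly S)) (rprod_pspan s) => [c u v|_ [t [pt ->]]].
  exact: linearP.
by apply: lspan_mem; exists t; split; [exact: pt | exact: comp_pprod].
Qed.

(** * Proper products indexed by their data *)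

Definition pp_of_list (s : seq nat) : pp_index n :=
  ([tuple count_mem (l : nat) s | l < (jj n).+1], sort leq [seq m <- s | jj n < m]%N).

Lemma pp_of_list_valid s : proper_list n s -> pp_valid (pp_of_list s).
Proof.
move=> ps; apply/and3P; split=> /=.
- by apply: sort_sorted; apply: leq_total.
- by rewrite all_sort filter_all.
by rewrite size_sort size_filter.
Qed.

Lemma proper_prod_of_list s :
  proper_prod F (pp_of_list s) = \prod_(m <- s) psum F n (2 * m + 1).
Proof.
rewrite /proper_prod /= (perm_big [seq m <- s | jj n < m]%N) ?perm_sort //=.
under eq_bigr => l _ do rewrite tnth_mktuple.
elim: s => [|m s IH].
  by rewrite !big_nil mulr1 big1 // => l _.
rewrite big_cons -IH /=.
under eq_bigr => l _ do rewrite exprD.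
rewrite big_split /= -mulrA.
case: (ltnP (jj n) m) => lm.
  rewrite big1 => [|l _]; last by rewrite gtn_eqF // (leq_trans _ lm).
  by rewrite mul1r big_cons mulrCA.
have lm' : (m < (jj n).+1)%N by [].
rewrite (bigD1 (Ordinal lm')) //= eqxx expr1 big1 ?mulr1 // => l.
by rewrite -val_eqE /= eq_sym => /negbTE->.
Qed.

Lemma supersym_proper_span f : mono_supersym f ->
  lspan (fun v => exists x : pp_index n, pp_valid x /\ v = proper_prod F x) f.
Proof.
move=> /supersym_pspan; apply: lspan_bind => _ [s [ps ->]]; apply: lspan_mem.
exists (pp_of_list s); split; first exact: pp_of_list_valid.
by rewrite proper_prod_of_list; reflexivity.
Qed.

Lemma supersym_proper_prod (x : pp_index n) : mono_supersym (proper_prod F x).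
Proof.
apply: supersymM; apply: supersym_prod => l _; first apply: supersymX.
  exact: supersym_psum.
exact: supersym_psum.
Qed.

Lemma proper_prod_comp (x : pp_index n) : proper_prod F x = gprod (pser e) x \mPo S.
Proof.
rewrite (rmorph_gprod (comp_mpoly S)); apply: (@eq_gprod _ _ (fun m => psum F n (2 * m + 1))) => m.
rewrite /= (rmorph_pser (comp_mpoly S)) psum_mesym.
by apply: eq_pser => t; rewrite /= evar_comp.
Qed.

Lemma proper_prod_indep (s : seq (pp_index n)) (a : pp_index n -> F) :
  (0 < n)%N -> uniq s -> all (@pp_valid n) s ->
  \sum_(x <- s) a x *: proper_prod F x = 0 -> forall x, x \in s -> a x = 0.
Proof.
move=> n0 us vs E; apply: (pser_prod_indep F0 n0 us vs).
apply: msym_fundamental_un0; rewrite -[RHS]E raddf_sum; apply: eq_bigr => x _.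
by rewrite /= comp_mpolyZ proper_prod_comp.
Qed.

(** * The algebra generated by the odd power sums *)

Definition odd_psum_alg m (f : {mpoly F[n]}) := exists q : {mpoly F[m]},
  f = mmap (fun c : F => c%:MP) (fun k : 'I_m => psum F n (2 * k + 1)) q.

Let ev m : {rmorphism {mpoly F[m]} -> {mpoly F[n]}} :=
  mmap (@mpolyC n F) (fun k : 'I_m => psum F n (2 * k + 1)).

(** Brings two elements to a common number of generators before they are added or multiplied. *)
Lemma odd_psum_alg_leq m m' f : (m <= m')%N -> odd_psum_alg m f -> odd_psum_alg m' f.
Proof.
move=> le [q ->]; exists (mmap (@mpolyC m' F) (fun k : 'I_m => 'X_(widen_ord le k)) q).
apply: (@mpoly_hom_ext _ _ _ (ev m) (ev m' \o mmap (@mpolyC m' F) _)) => [c|k] /=.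
  by rewrite !mmapC.
by rewrite !mmapX !mmap1U mmapX mmap1U.
Qed.

Lemma in_odd_psum_algD (f g : {mpoly F[n]}) :
  in_odd_psum_alg f -> in_odd_psum_alg g -> in_odd_psum_alg (f + g).
Proof.
move=> [m Hf] [m' Hg]; exists (maxn m m').
have [q Eq] := odd_psum_alg_leq (leq_maxl m m') Hf.
have [q' Eq'] := odd_psum_alg_leq (leq_maxr m m') Hg.
by exists (q + q'); rewrite Eq Eq'; symmetry; apply: (rmorphD (ev _)).
Qed.

Lemma in_odd_psum_algM (f g : {mpoly F[n]}) :
  in_odd_psum_alg f -> in_odd_psum_alg g -> in_odd_psum_alg (f * g).
Proof.
move=> [m Hf] [m' Hg]; exists (maxn m m').
have [q Eq] := odd_psum_alg_leq (leq_maxl m m') Hf.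
have [q' Eq'] := odd_psum_alg_leq (leq_maxr m m') Hg.
by exists (q * q'); rewrite Eq Eq'; symmetry; apply: (rmorphM (ev _)).
Qed.

Lemma in_odd_psum_algC c : in_odd_psum_alg (c%:MP : {mpoly F[n]}).
Proof. by exists 0%N, c%:MP; symmetry; apply: (mmapC _ (@mpolyC n F)). Qed.

Lemma in_odd_psum_alg_psum m : in_odd_psum_alg (psum F n (2 * m + 1)).
Proof.
exists m.+1, 'X_(ord_max); symmetry; apply: etrans (mmapX _ (@mpolyC n F) _) _.
by rewrite mmap1U.
Qed.

Lemma supersym_in_odd_psum_alg (f : {mpoly F[n]}) : mono_supersym f <-> in_odd_psum_alg f.
Proof.
split=> [/supersym_pspan|[m [q ->]]].
  have z := in_odd_psum_algC 0; rewrite mpolyC0 in z.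
  elim=> [//|c u w [s [_ ->]] _ IH]; apply: in_odd_psum_algD IH.
  rewrite -mul_mpolyC; apply: in_odd_psum_algM; first exact: in_odd_psum_algC.
  apply: big_ind => [||l _]; [|exact: in_odd_psum_algM|exact: in_odd_psum_alg_psum].
  by have := in_odd_psum_algC 1; rewrite mpolyC1.
have -> : mmap (fun c : F => c%:MP) (fun k : 'I_m => psum F n (2 * k + 1)) q = ev m q by [].
elim/mpoly_ring_ind: q => [c|k|p q Tp Tq|p q Tp Tq].
- by rewrite /= mmapC; apply: supersymC.
- by rewrite /= mmapX mmap1U; apply: supersym_psum.
- by rewrite rmorphD; apply: supersymD Tq.
by rewrite rmorphM; apply: supersymM Tq.
Qed.

End Generation.

Theorem theorem1 (F : fieldType) (n : nat) :
  [pchar F] =i pred0 -> (0 < n)%N ->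
  (* T_n is generated as an F-algebra by the odd power sums *)
  (forall p : {mpoly F[n]}, mono_supersym p <-> in_odd_psum_alg p) /\
  (* proper products lie in T_n *)
  (forall x : pp_index n, pp_valid x -> mono_supersym (proper_prod F x)) /\
  (* linear independence *)
  (forall (s : seq (pp_index n)) (a : pp_index n -> F),
      uniq s -> all (@pp_valid n) s ->
      \sum_(x <- s) a x *: proper_prod F x = 0 ->
      forall x, x \in s -> a x = 0) /\
  (* spanning *)
  (forall p : {mpoly F[n]}, mono_supersym p ->
      exists (s : seq (pp_index n)) (a : pp_index n -> F),
        all (@pp_valid n) s /\ p = \sum_(x <- s) a x *: proper_prod F x).
Proof.
move=> F0 n0; split; first by move=> p; apply: supersym_in_odd_psum_alg.
split; first by move=> x _; apply: supersym_proper_prod.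
split=> [s a|p Tp]; first exact: proper_prod_indep.
exact: lspan_finite (supersym_proper_span F0 Tp).
Qed.
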